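(* For any positive integers $m$ and $n$ with $n\ge m-1$, the normalized volume $v(m,n)$ of the partial permutohedron $\mathcal{P}(m,n)$ is given recursively by $$v(m,n)=(m-1)!\,\sum_{k=1}^m k^{k-2}\,\frac{v(m-k,n-k)}{(m-k)!}\left(kn-\binom{k}{2}\right)\binom{m}{k},$$ with initial condition $v(0,n)=1$ (for every integer $n\ge-1$) and with the convention $v(1,0)=0$. Furthermore, for fixed $m$, $v(m,n)$ with $n\ge m-1$ is given by a polynomial in $n$ of degree $m$.
   Context: For positive integers $m,n$, the partial permutohedron $\mathcal{P}(m,n)\subseteq\mathbb{R}^m$ is the convex hull of all vectors in $\{0,1,\ldots,n\}^m$ whose nonzero entries are distinct; it is an $m$-dimensional lattice polytope. Its normalized volume is $v(m,n)=m!\cdot\mathrm{Vol}(\mathcal{P}(m,n))$, where $\mathrm{Vol}$ is Lebesgue measure on $\mathbb{R}^m$. *)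

(* Defs.v *)
From HB Require Import structures.
From mathcomp Require Import all_boot all_order all_algebra.
From mathcomp Require Import all_classical all_reals all_analysis.

Set Implicit Arguments.
Unset Strict Implicit.
Unset Printing Implicit Defensive.

Import Order.TTheory GRing.Theory Num.Theory.
Import numFieldNormedType.Exports.

Local Open Scope classical_set_scope.
Local Open Scope ring_scope.

Definition cons_pair (T : Type) (m : nat) (p : (T * m.-tuple T)%type) :
  m.+1.-tuple T := [tuple of p.1 :: p.2].

(* Lebesgue measure on R^m, as the m-fold product of [lebesgue_measure]
   transported to m-tuples; on R^0 it is the unit point mass.
   [lebesgue_tuple_box] gives its value on boxes. *)
Fixpoint lebesgue_tuple (R : realType) (m : nat) :
    set (m.-tuple (measurableTypeR R)) -> \bar R :=
  match m with
  | 0%N => \d_ ([tuple] : 0.-tuple (measurableTypeR R))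
  | m'.+1 => pushforward
      (product_measure1 (@lebesgue_measure R) (@lebesgue_tuple R m'))
      (@cons_pair (measurableTypeR R) m')
  end.

Lemma measurable_cons_pair d (T : measurableType d) (m : nat) :
  measurable_fun setT (@cons_pair T m).
Proof. exact: measurable_cons. Qed.

Definition cons_measure d (T : measurableType d) (R : realType) (m : nat)
    (l : {sigma_finite_measure set T -> \bar R})
    (mu : {sigma_finite_measure set (m.-tuple T) -> \bar R}) :=
  pushforward (product_measure1 l mu) (@cons_pair T m).

Section cons_measure.
Context d (T : measurableType d) (R : realType) (m : nat).
Variables (l : {sigma_finite_measure set T -> \bar R})
  (mu : {sigma_finite_measure set (m.-tuple T) -> \bar R}).
Local Notation nu := (cons_measure l mu).
Let mf := @measurable_cons_pair _ T m.

Let nu0 : nu set0 = 0%E.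
Proof. by rewrite /cons_measure /pushforward preimage_set0 measure0. Qed.

Let nu_ge0 A : (0 <= nu A)%E. Proof. exact: measure_ge0. Qed.

Let nu_sigma_additive : semi_sigma_additive nu.
Proof.
move=> F Fm tF mUF; rewrite /cons_measure /pushforward preimage_bigcup.
apply: measure_semi_sigma_additive.
- by move=> n; rewrite -[X in measurable X]setTI; exact: mf.
- apply/trivIsetP => /= i j _ _ ij; rewrite -preimage_setI.
  by move/trivIsetP : tF => /(_ _ _ _ _ ij) ->//; rewrite preimage_set0.
- by rewrite -preimage_bigcup -[X in measurable X]setTI; exact: mf.
Qed.

HB.instance Definition _ :=
  isMeasure.Build _ _ _ nu nu0 nu_ge0 nu_sigma_additive.

Let nu_sigma_finite : sigma_finite setT nu.
Proof.
have /sigma_finiteP[F [FT ndF Foo]] := sigma_finiteT l.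
have /sigma_finiteP[G [GT ndG Goo]] := sigma_finiteT mu.
pose g (t : m.+1.-tuple T) := (thead t, [tuple of behead t]).
have gK : cancel (@cons_pair T m) g.
  by move=> [x t]; rewrite /g /=; congr pair; apply: val_inj.
have mg : measurable_fun setT g.
  apply/measurable_fun_pair => /=.
    exact: measurable_tnth.
  exact: measurable_behead.
have mFG i : measurable (F i `*` G i).
  by apply: measurableX; [exact: (Foo i).1|exact: (Goo i).1].
exists (fun i => g @^-1` (F i `*` G i)).
  apply/seteqP; split => // t _.
  have [i _ Fi] : (\bigcup_i F i) (thead t) by rewrite -FT.
  have [j _ Gj] : (\bigcup_i G i) [tuple of behead t] by rewrite -GT.
  exists (maxn i j) => //; split => /=.
  - by move: Fi; exact/subsetPset/ndF/leq_maxl.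
  - by move: Gj; exact/subsetPset/ndG/leq_maxr.
move=> i; split.
  by rewrite -[X in measurable X]setTI; apply: mg => //; exact: mFG.
rewrite /cons_measure /pushforward -comp_preimage.
have -> : (g \o @cons_pair T m) = id by apply/funext => x /=; rewrite gK.
rewrite preimage_id product_measure1E; [|exact: (Foo i).1|exact: (Goo i).1].
by rewrite lte_mul_pinfty// ?ge0_fin_numE//; [exact: (Foo i).2|exact: (Goo i).2].
Qed.

HB.instance Definition _ :=
  Measure_isSigmaFinite.Build _ _ _ nu nu_sigma_finite.

End cons_measure.

Lemma lebesgue_tuple_exists (R : realType) (m : nat) :
  {mu : {sigma_finite_measure set (m.-tuple (measurableTypeR R)) -> \bar R} |
    (mu : set _ -> \bar R) = @lebesgue_tuple R m}.
Proof.
elim: m => [|m [mu muE]].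
  by exists (\d_ ([tuple] : 0.-tuple (measurableTypeR R))).
by exists (cons_measure (@lebesgue_measure R) mu); rewrite /= -muE.
Qed.

Section lebesgue_tuple_measure.
Context (R : realType) (m : nat).
Local Notation leb := (@lebesgue_tuple R m).

Let leb0 : leb set0 = 0%E.
Proof. by have [mu <-] := lebesgue_tuple_exists R m; rewrite measure0. Qed.

Let leb_ge0 A : (0 <= leb A)%E.
Proof. by have [mu <-] := lebesgue_tuple_exists R m; rewrite measure_ge0. Qed.

Let leb_sigma_additive : semi_sigma_additive leb.
Proof.
have [mu <-] := lebesgue_tuple_exists R m.
exact: measure_semi_sigma_additive.
Qed.

HB.instance Definition _ :=
  isMeasure.Build _ _ _ leb leb0 leb_ge0 leb_sigma_additive.

Let leb_sigma_finite : sigma_finite setT leb.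
Proof.
have [mu <-] := lebesgue_tuple_exists R m; exact: sigma_finiteT.
Qed.

HB.instance Definition _ :=
  Measure_isSigmaFinite.Build _ _ _ leb leb_sigma_finite.

End lebesgue_tuple_measure.

Lemma lebesgue_tuple_box (R : realType) (m : nat)
    (A : 'I_m -> set (measurableTypeR R)) :
  (forall i, measurable (A i)) ->
  @lebesgue_tuple R m [set t | forall i, A i (tnth t i)] =
  (\prod_(i < m) lebesgue_measure (A i))%E.
Proof.
elim: m => [|m IH] in A *.
  move=> _; rewrite big_ord0 /= diracE mem_set//.
  by case.
move=> mA; rewrite big_ord_recl -IH; last by move=> i; exact: mA.
rewrite -(@product_measure1E _ _ _ _ _ lebesgue_measure (@lebesgue_tuple R m))//=.
- rewrite /pushforward; congr product_measure1; apply/seteqP; split => -[x t] /=.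
  + move=> H; split => [|i]; first exact: (H ord0).
    by move: (H (lift ord0 i)); rewrite tnthS.
  + move=> [Hx Ht] i; have [j ->|->] := unliftP ord0 i; last exact: Hx.
    by rewrite tnthS; exact: Ht.
- rewrite [X in measurable X](_ : _ = \bigcap_(i in [set: 'I_m])
    ((fun t => tnth t i) @^-1` A (lift ord0 i))); last first.
    by apply/seteqP; split => t /= H i => [_|]; exact: H.
  apply: fin_bigcap_measurable => // i _.
  rewrite -[X in measurable X]setTI; exact: measurable_tnth.
Qed.

Definition volume (R : realType) (m : nat) (A : set 'rV[R]_m) : \bar R :=
  @lebesgue_tuple R m [set t | A (\row_i tnth t i)].

Definition convex_hull (R : realType) (m : nat) (A : set 'rV[R]_m) :
    set 'rV[R]_m :=
  smallest (@convex_set R 'rV[R]_m) A.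

Definition partial_perm_vectors (R : realType) (m n : nat) : set 'rV[R]_m :=
  [set x | (forall i, exists2 k : nat, (k <= n)%N & x ord0 i = k%:R) /\
           (forall i j, x ord0 i != 0 -> x ord0 i = x ord0 j -> i = j)].

Definition partial_permutohedron (R : realType) (m n : nat) : set 'rV[R]_m :=
  convex_hull (@partial_perm_vectors R m n).

(* The normalized volume v(m, n). The second argument is an integer because the
   recursion for v(m, n) with n = m - 1 involves v(0, -1). The first two clauses
   are conventions; the value at n < 0 < m is junk. *)
Definition nvolume (R : realType) (m : nat) (n : int) : R :=
  match m, n with
  | 0%N, _ => 1
  | 1%N, Posz 0%N => 0
  | _, Posz n' => m`!%:R * fine (volume (@partial_permutohedron R m n'))
  | _, Negz _ => 0
  end.

(* Main.v *)
Require Import Defs.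
From mathcomp Require Import all_boot all_order all_algebra.
From mathcomp Require Import all_classical all_reals all_analysis.
From mathcomp Require Import measurable_realfun.
From mathcomp Require Import ring lra zify.

Import Order.TTheory GRing.Theory Num.Theory.
Local Open Scope ring_scope.

(** Write f(j) = n + (n-1) + ... + (n-j+1) and x(A) for the sum of the
coordinates of x over A.  When n >= m-1, P(m,n) is the polymatroid
{x >= 0 | x(A) <= f(|A|) for all A} ([partial_permutohedronE]).  The generating
vectors satisfy these inequalities.  Conversely, f being strictly concave, the
tight sets of a point form a chain; unless the point is a generating vector,
it lies inside a segment of the polymatroid along a direction e_i - e_j or e_i
that keeps the tight constraints tight, and the ends of that segment have more
tight constraints ([vertex_or_edge], [polyhedron_sub_convex]).

The polymatroid P(m,t) makes sense for every real t.  Projecting P(m+1,t) along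
its first coordinate gives P(m,t), and the fibre over x is [0, g(x)], where
g(x) is the minimum over A of the slack f(|A|+1) - x(A).  Cut P(m,t) according
to a set S of size k where the slack is minimal.  By submodularity this
minimality can be tested on the subsets and on the supersets of S only, so a
piece is a product: the coordinates in S range over a polytope Q_k, and those
outside S range over P(m-k,t-k-1) ([minimizer_split_at], [split_at_minimizer],
[split_at_polymatroid]).  Two pieces overlap in a hyperplane.  The polytope Q_k
is the permutohedron of (t, t-1, ..., t-k) with one coordinate forgotten, so
its volume q_k does not depend on t; its central symmetry x -> 2t-k-x maps the
forgotten coordinate g to 2t-k-g, so that g has mean t-k/2 over Q_k
([tall_block_vol]).  With v_m(t) the volume of P(m,t), it follows for t >= m
that ([pvol_recursion], [pvolS_recursion])

  v_m(t)     = sum_k C(m,k) q_k v_(m-k)(t-k-1),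
  v_(m+1)(t) = sum_k C(m,k) q_k (t-k/2) v_(m-k)(t-k-1).

The second identity is the recursion to be proved as soon as
q_k = (k+1)^(k-1), the number of trees on k+1 vertices.  No separate
computation of the volume of the permutohedron is needed, because the two
identities together determine q.  Indeed the second one shows that v_m is a
polynomial; differentiating it and using the first one gives
v_(m+1)' = (m+1) v_m ([deriv_appell]).  For such an Appell sequence, comparing
constant terms in the first identity yields
sum_k C(n,k) q_k (-(k+1))^(n-k) = 0 for n >= 1, and (k+1)^(k-1) is the only
solution, since the n-th difference of a polynomial of degree n-1 vanishes
([weights_of_recursions]). *)

Set Implicit Arguments.
Unset Strict Implicit.
Unset Printing Implicit Defensive.

(** * The polymatroid and the minimizers of the slack *)

Section rank.
Context {R : realType}.
Implicit Types (t : R) (j k : nat).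

(** t + (t - 1) + ... + (t - j + 1): the largest sum of j coordinates that is
allowed when t plays the role of n. *)
Definition top_sum t j : R := j%:R * t - j%:R * (j%:R - 1) / 2.

(** (t - k) + (t - k + 1) + ... : the sum of the j smallest among
t, t - 1, ..., t - k. *)
Definition bottom_sum t k j : R := j%:R * (t - k%:R) + j%:R * (j%:R - 1) / 2.

Lemma top_sum0 t : top_sum t 0 = 0. Proof. by rewrite /top_sum !mul0r subr0. Qed.

Lemma bottom_sumE t k j : (j <= k)%N -> bottom_sum t k j = top_sum t k.+1 - top_sum t (k - j).+1.
Proof. by move=> jk; rewrite /bottom_sum /top_sum !mulrSr natrB//; field. Qed.

Lemma top_sum_shift t k j :
  top_sum (t - k.+1%:R) j = top_sum t (k + j).+1 - top_sum t k.+1.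
Proof. by rewrite /top_sum !mulrSr natrD; field. Qed.

(** The increments t - j of [top_sum] decrease with j; this is what makes
A |-> top_sum t #|A| submodular. *)
Lemma top_sum_concave t (a b s : nat) : (a <= s)%N ->
  top_sum t (s + b) - top_sum t s <= top_sum t (a + b) - top_sum t a.
Proof.
move=> as_; rewrite -subr_ge0 /top_sum !natrD.
rewrite [leRHS](_ : _ = b%:R * (s%:R - a%:R)); last by field.
by rewrite mulr_ge0// subr_ge0 ler_nat.
Qed.

Lemma top_sum_reflect t t' k j : j%:R * (t + t' - k%:R) - top_sum t j = bottom_sum t' k j.
Proof. by rewrite /bottom_sum /top_sum; field. Qed.

End rank.

Section tight_split.
Import boot.finset.
Context {R : realType} (T : finType) (x : T -> R).
Implicit Types (t : R) (A S : {set T}).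

Definition setsum A : R := \sum_(i in A) x i.

Definition in_polymatroid t :=
  (forall i, 0 <= x i) /\ (forall A, setsum A <= top_sum t #|A|).

(** Bound that A puts on an extra coordinate: if a coordinate y is added to x,
the constraint of A together with y reads y <= slack t A. *)
Definition slack t A := top_sum t #|A|.+1 - setsum A.

(** The first clause says that x restricted to S lies in the permutohedron of
t, ..., t - #|S| with one coordinate forgotten; the other two say that x
restricted to the complement of S lies in the polymatroid for t - #|S| - 1. *)
Definition split_at t S :=
  (forall A, A \subset S -> bottom_sum t #|S| #|A| <= setsum A <= top_sum t #|A|) /\
  (forall i, i \notin S -> 0 <= x i) /\
  (forall A, A \subset ~: S -> setsum A <= top_sum (t - #|S|.+1%:R) #|A|).

Lemma setsumID A S : setsum A = setsum (A :&: S) + setsum (A :\: S).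
Proof. by rewrite /setsum [LHS](big_setID S). Qed.

(** Minimality is used only against the sets S :\: A with A inside S, which give the
lower bounds, and against S :|: A with A outside S, which give the upper ones. *)
Lemma minimizer_split_at t S : in_polymatroid t ->
  (forall A, slack t S <= slack t A) -> split_at t S.
Proof.
move=> [x0 xP] Smin; split; [|split] => // A AS.
- rewrite xP andbT bottom_sumE ?subset_leq_card//.
  have := Smin (S :\: A); rewrite /slack (setsumID S A) cardsD.
  have /setIidPr -> := AS.
  lra.
- rewrite top_sum_shift; have := Smin (S :|: A); rewrite /slack.
  have SA : [disjoint S & A].
    by rewrite disjoint_sym disjoints_subset.
  have -> : setsum (S :|: A) = setsum S + setsum A.
    by rewrite /setsum -bigU//; apply: eq_bigl => i; rewrite inE.
  rewrite cardsU (_ : #|S :&: A| = 0%N) ?subn0; first lra.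
  by apply/eqP; rewrite cards_eq0 setI_eq0.
Qed.

(** An arbitrary A is compared with S through A :&: S and A :|: S, by
submodularity of the slack. *)
Lemma split_at_minimizer t S : split_at t S ->
  forall A, slack t S <= slack t A.
Proof.
move=> [xS [_ xC]] A; rewrite /slack.
have /andP[H1 _] := xS (S :\: A) (subsetDl _ _).
have H2 : setsum (A :\: S) <= _ := xC (A :\: S) (subsetDr _ _).
move: H1 H2; rewrite bottom_sumE ?subset_leq_card ?subsetDl// top_sum_shift.
rewrite (setsumID S A) (setsumID A S) [A :&: S]setIC.
rewrite [(#|S| - _)%N](_ : _ = #|S :&: A|); last first.
  by have := cardsID A S; lia.
have -> : #|A| = (#|S :&: A| + #|A :\: S|)%N by rewrite -(cardsID S A) setIC.
have := @top_sum_concave R t #|S :&: A|.+1 #|A :\: S| #|S|.+1.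
rewrite !addSn ltnS subset_leq_card ?subsetIl// => /(_ isT); lra.
Qed.

(** Nonnegativity on S comes from the lower bound t - #|S| on single coordinates,
hence the lower bound on t. *)
Lemma split_at_polymatroid t S : #|S|%:R <= t -> split_at t S ->
  in_polymatroid t.
Proof.
move=> St [xS [x0 xC]]; split.
- move=> i; have [iS|/x0//] := boolP (i \in S).
  have i1S : [set i]%SET \subset S by rewrite sub1set.
  by have /andP[+ _] := xS _ i1S; rewrite /setsum big_set1 cards1 /bottom_sum; lra.
- move=> A; rewrite (setsumID A S).
  have /andP[_ H1] := xS (A :&: S) (subsetIr _ _).
  have := xC (A :\: S) (subsetDr _ _); rewrite top_sum_shift.
  have := @top_sum_concave R t #|A :&: S| #|A :\: S| #|S|.+1.
  rewrite leqW ?subset_leq_card ?subsetIr// => /(_ isT).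
  rewrite cardsID addSn; lra.
Qed.

End tight_split.

(** * The convex hull is the polymatroid *)

Section moving.
Context {R : realType}.

(** Ratio test: s lists the slacks of the constraints at a point and l their rates
of change along a direction; the first constraint to reach zero bounds the move. *)
Lemma move_to_tight (I : finType) (s l : I -> R) :
  (forall c, 0 <= s c) -> (forall c, s c = 0 -> l c = 0) ->
  (exists c, l c < 0) ->
  exists a, [/\ 0 < a, forall c, 0 <= s c + a * l c &
    exists c, s c != 0 /\ s c + a * l c = 0].
Proof.
move=> s0 sl [c0 lc0].
case: (@arg_minP _ _ I c0 (fun c => l c < 0) (fun c => s c / - l c) lc0).
move=> c lc cmin; have sc : s c != 0.
  by apply: contraTneq lc => /sl ->; rewrite ltxx.
have sc0 : 0 < s c by rewrite lt_def sc s0.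
exists (s c / - l c); split.
- by rewrite divr_gt0// oppr_gt0.
- move=> b; have [lb|lb] := ltP (l b) 0; last first.
    by rewrite addr_ge0// mulr_ge0// divr_ge0// ?s0// oppr_ge0 ltW.
  have := cmin _ lb; rewrite ler_pdivlMr ?oppr_gt0// mulrN; lra.
- exists c; split => //; rewrite invrN mulrN mulNr mulfVK ?subrr//.
  by rewrite lt_eqF.
Qed.

Variable V : lmodType R.

Lemma conv_between (A : set V) (x d : V) (a b : R) :
  convex_set A -> 0 < a -> 0 < b ->
  A (x + a *: d) -> A (x - b *: d) -> A x.
Proof.
move=> cA a0 b0 A1 A2.
(* x divides the segment in the ratio a : b. *)
have p0 : 0 <= b / (a + b) by rewrite divr_ge0// ?addr_ge0// ltW.
have p1 : b / (a + b) <= 1.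
  by rewrite ler_pdivrMr ?addr_gt0// mul1r lerDr ltW.
have := cA _ _ (Itv01 p0 p1) (mem_set A1) (mem_set A2).
rewrite inE; congr A.
rewrite /conv /= /unstable.onem.
have ab : a + b != 0 by rewrite gt_eqF// addr_gt0.
rewrite !scalerDr addrACA -scalerDl addrC scalerN !scalerA.
rewrite [_ * a](_ : _ = (1 - b / (a + b)) * b); last by field.
by rewrite subrr add0r addrC subrK scale1r.
Qed.

(** Each point outside A that satisfies the constraints is moved both ways along d
until a constraint becomes tight.  Both ends have fewer constraints that are not
tight, so the induction on their number puts them in A, and convexity brings
the point back into A. *)
Lemma polyhedron_sub_convex (I : finType) (s l : I -> V -> R) (A : set V) :
  (forall c x d a, s c (x + a *: d) = s c x + a * l c d) ->
  convex_set A ->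
  (forall x, (forall c, 0 <= s c x) -> A x \/ exists d : V,
    [/\ forall c, s c x = 0 -> l c d = 0, exists c, l c d < 0 &
       exists c, 0 < l c d]) ->
  forall x, (forall c, 0 <= s c x) -> A x.
Proof.
move=> sE cA step x.
have [n] := ubnP #|[set c | s c x != 0%R]|; elim: n x => // n IH x xn x0.
have [//|[d [tight neg pos]]] := step _ x0.
have fewer (y : V) : (forall c, s c x = 0 -> s c y = 0) ->
    (exists c, s c x != 0 /\ s c y = 0) ->
    (#|[set c | s c y != 0%R]| < n)%N.
  move=> xy [c [cx cy]]; apply: (@leq_trans #|[set c | s c x != 0%R]|); last first.
    by rewrite -ltnS.
  apply: proper_card; apply/properP; split.
    apply/fintype.subsetP => b; rewrite !inE; apply: contra => /eqP /xy ->.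
    by rewrite eqxx.
  by exists c; rewrite !inE ?cy ?eqxx.
have [a [a0 xa [ca [cax cae]]]] := move_to_tight x0 tight neg.
have [||b [b0 xb [cb [cbx cbe]]]] := @move_to_tight I (s^~ x) (fun c => - l c d) x0.
- by move=> c /tight ->; rewrite oppr0.
- by have [c lc] := pos; exists c; rewrite oppr_lt0.
have sb c : s c (x - b *: d) = s c x + b * - l c d.
  by rewrite -scaleNr sE mulNr mulrN.
apply: (conv_between (d := d) cA a0 b0); apply: IH.
- apply: fewer => [c xc|]; first by rewrite sE xc tight// mulr0 addr0.
  by exists ca; rewrite sE.
- by move=> c; rewrite sE.
- apply: fewer => [c xc|]; first by rewrite sb xc tight// oppr0 mulr0 addr0.
  by exists cb; rewrite sb.
- by move=> c; rewrite sb.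
Qed.

End moving.

Section vertices.
Import boot.finset.
Context {R : realType} (T : finType) (x : T -> R) (n : nat).
Hypothesis Tn : (#|T| <= n.+1)%N.
Hypothesis xP : in_polymatroid x n%:R.

Let tight A := setsum x A == top_sum n%:R #|A|.

(** The submodularity defect of [top_sum] at A and B is exactly
#|A :\: B| * #|B :\: A|, and tightness of both sets forces it to vanish. *)
Lemma tight_chain A B : tight A -> tight B -> (A \subset B) || (B \subset A).
Proof.
move=> /eqP tA /eqP tB; apply: contraT; rewrite negb_or -!setD_eq0 -!card_gt0.
move=> /andP[AB BA]; have [_ x_le] := xP.
have := x_le (A :&: B); have := x_le (A :|: B).
have cU : #|A :|: B| = (#|A :&: B| + #|A :\: B| + #|B :\: A|)%N.
  by have := cardsID B A; have := cardsID A B; have := cardsUI A B;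
    rewrite [B :&: A]setIC; lia.
have cA : #|A| = (#|A :&: B| + #|A :\: B|)%N by rewrite cardsID.
have cB : #|B| = (#|A :&: B| + #|B :\: A|)%N by rewrite setIC cardsID.
have sU : setsum x (A :|: B) = setsum x A + setsum x (B :\: A).
  rewrite (setsumID x (A :|: B) A) finset.setUK.
  by congr (_ + setsum x _); apply/setP => i; rewrite !inE; case: (i \in A).
have sB : setsum x B = setsum x (A :&: B) + setsum x (B :\: A).
  by rewrite (setsumID x B A) setIC.
have : top_sum n%:R #|A| + top_sum n%:R #|B| = top_sum n%:R #|A :&: B| + top_sum n%:R #|A :|: B|
    + #|A :\: B|%:R * #|B :\: A|%:R :> R.
  by rewrite cU cA cB /top_sum !natrD; field.
have : 0 < #|A :\: B|%:R * #|B :\: A|%:R :> R by rewrite mulr_gt0// ltr0n.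
by rewrite -tA -tB sU sB; lra.
Qed.

(** If no direction e_i - e_j or e_i preserves the tight sets, then positive
coordinates are covered and separated by tight sets.  The smallest tight set
containing i then exceeds the largest tight set avoiding i by i alone, and x i
is the difference of two consecutive values of [top_sum]. *)
Lemma vertex_or_edge :
  [\/ exists i j, [/\ i != j, 0 < x i, 0 < x j &
        forall A, tight A -> (i \in A) = (j \in A)],
      exists2 i, 0 < x i & forall A, tight A -> i \notin A |
      (forall i, exists2 k : nat, (k <= n)%N & x i = k%:R) /\
      (forall i j, x i != 0 -> x i = x j -> i = j)].
Proof.
have [x0 x_le] := xP.
have [H|sep] := pselect (exists i j, [/\ i != j, 0 < x i, 0 < x j &
        forall A, tight A -> (i \in A) = (j \in A)]); first by constructor 1.
have [H|cov] := pselect (exists2 i, 0 < x i & forall A, tight A -> i \notin A).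
  by constructor 2.
constructor 3.
have {}cov i : 0 < x i -> exists2 A, tight A & i \in A.
  move=> xi; apply: contrapT => H; apply: cov; exists i => // A tA.
  by apply/negP => iA; apply: H; exists A.
have {}sep i j : i != j -> 0 < x i -> 0 < x j ->
    exists2 A, tight A & (i \in A) != (j \in A).
  move=> ij xi xj; apply: contrapT => H; apply: sep; exists i, j; split => // A tA.
  by apply/eqP; apply: contrapT => /negP ijA; apply: H; exists A.
have tight0 : tight set0 by rewrite /tight /setsum big_set0 cards0 top_sum0.
have le_sub A B : tight A -> tight B -> (#|A| <= #|B|)%N -> A \subset B.
  move=> tA tB AB; have /orP[//|BA] := tight_chain tA tB.
  by have /eqP -> : B == A by rewrite eqEcard BA.
pose is_min i A := [/\ tight A, i \in A &
  forall C, tight C -> i \in C -> A \subset C].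
have minA i : 0 < x i -> exists A, is_min i A.
  move=> /cov[A0 tA0 iA0].
  have PA0 : tight A0 && (i \in A0) by rewrite tA0.
  case: (@arg_minnP _ A0 (fun A => tight A && (i \in A)) (fun A => #|A|) PA0).
  move=> A /andP[tA iA] Amin; exists A; split => // C tC iC.
  by apply: le_sub => //; apply: Amin; rewrite tC.
have capS k : top_sum n%:R k.+1 = top_sum n%:R k + (n%:R - k%:R) :> R.
  by rewrite /top_sum mulrSr; field.
have value i A : 0 < x i -> is_min i A -> x i = n%:R - #|A|.-1%:R.
  move=> xi [tA iA Amin].
  have P0 : tight set0 && (i \notin (set0 : {set T})) by rewrite tight0 inE.
  case: (@arg_maxnP _ set0 (fun B => tight B && (i \notin B)) (fun B => #|B|) P0).
  move=> B /andP[tB iB] Bmax.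
  have BA : B \subset A.
    have /orP[//|/fintype.subsetP /(_ i iA)] := tight_chain tB tA.
    by rewrite (negPf iB).
  have An : (#|A| <= n.+1)%N by apply: leq_trans Tn; exact: max_card.
  have AB : A = i |: B.
    apply/eqP; rewrite eqEsubset subUset sub1set iA BA !andbT.
    apply/fintype.subsetP => j jA; rewrite !inE; apply: contraT.
    rewrite negb_or => /andP[ji jB].
    have := x0 j; rewrite le_eqVlt => /predU1P[xj|xj].
      have tAj : tight (A :\ j).
        have cA : #|A| = #|A :\ j|.+1 by rewrite (cardsD1 j A) jA.
        have sA : setsum x A = setsum x (A :\ j).
          by rewrite /setsum (big_setD1 _ jA) /= -xj add0r.
        rewrite /tight eq_le x_le /= -sA (eqP tA) cA capS lerDl subr_ge0 ler_nat.
        by rewrite -ltnS -cA.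
      have := Amin _ tAj; rewrite !inE eq_sym ji iA => /(_ isT).
      by move=> /fintype.subsetP /(_ j jA); rewrite !inE eqxx.
    have [C tC] := sep _ _ ji xj xi.
    have [iC|iC] := boolP (i \in C).
      by rewrite (fintype.subsetP (Amin _ tC iC) _ jA).
    rewrite eqbF_neg negbK => jC.
    (* C avoids i, so it is no larger than B, which leaves no room for j. *)
    have CB : C \subset B by apply: le_sub => //; apply: Bmax; rewrite tC.
    by move: jB; rewrite (fintype.subsetP CB _ jC).
  have := eqP tA; rewrite AB cardsU1 iB /setsum big_setU1//= -/(setsum x B).
  by rewrite (eqP tB) capS /=; lra.
split.
- move=> i; have := x0 i; rewrite le_eqVlt => /predU1P[<-|xi]; first by exists 0%N.
  have [A Ai] := minA _ xi; exists (n - #|A|.-1)%N; first exact: leq_subr.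
  rewrite natrB; first exact: value.
  have : (#|A| <= n.+1)%N by apply: leq_trans Tn; exact: max_card.
  by case: #|A|.
- move=> i j xi0 xij.
  have xi : 0 < x i by rewrite lt_def xi0 x0.
  have xj : 0 < x j by rewrite -xij.
  have [A Ai] := minA _ xi; have [B Bj] := minA _ xj.
  have AB : #|A| = #|B|.
    have := value _ _ xi Ai; rewrite xij (value _ _ xj Bj).
    move=> /addrI /oppr_inj /eqP; rewrite eqr_nat => /eqP.
    have [_ iA _] := Ai; have [_ jB _] := Bj.
    have : (0 < #|A|)%N by apply/card_gt0P; exists i.
    have : (0 < #|B|)%N by apply/card_gt0P; exists j.
    by lia.
  have [tA iA Amin] := Ai; have [tB jB Bmin] := Bj.
  have {}AB : A = B.
    by apply/eqP; rewrite eqEsubset !le_sub// AB.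
  apply: contrapT => /eqP ij; have [C tC] := sep _ _ ij xi xj.
  rewrite -AB in Bmin jB.
  have [iC|iC] := boolP (i \in C).
    by rewrite (fintype.subsetP (Amin _ tC iC) _ jB).
  have [jC|//] := boolP (j \in C).
  by rewrite (fintype.subsetP (Bmin _ tC jC) _ iA) in iC.
Qed.

End vertices.

Section vectors.
Context {R : realType}.

(** Among j + 1 distinct positive values bounded by n one is at most n - j; removing
its index reduces the bound for j + 1 coordinates to the one for j. *)
Lemma partial_perm_in_polymatroid (T : finType) (x : T -> R) n :
  (#|T| <= n.+1)%N ->
  (forall i, exists2 k : nat, (k <= n)%N & x i = k%:R) ->
  (forall i j, x i != 0 -> x i = x j -> i = j) -> in_polymatroid x n%:R.
Proof.
move=> Tn xk0 xinj.
have /choice[k kP] i : exists k : nat, (k <= n)%N /\ x i = k%:R.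
  by have [k] := xk0 i; exists k.
have kn i : (k i <= n)%N by have [] := kP i.
have xk i : x i = (k i)%:R by have [] := kP i.
split=> [i|A]; first by rewrite xk.
have [j] := ubnPeq #|A|; elim: j A => [|j IH] A /eqP cA.
  have -> : A = finset.set0 by apply/eqP; rewrite -cards_eq0; exact/eqP.
  by rewrite top_sum0 /setsum big_set0.
have [i iA ki] : exists2 i, i \in A & (k i <= n - j)%N.
  apply: contrapT => H.
  have big i : i \in A -> (n - j < k i)%N.
    by move=> iA; rewrite ltnNge; apply/negP => ki; apply: H; exists i.
  (* Otherwise j + 1 distinct values would fit into the j integers of (n - j, n]. *)
  have : (size [seq k i | i <- enum A] <= size (iota (n - j).+1 j))%N.
    apply: uniq_leq_size.
      rewrite map_inj_in_uniq ?enum_uniq// => i i'; rewrite !mem_enum => iA _ kk.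
      apply: xinj; last by rewrite !xk kk.
      by rewrite xk pnatr_eq0 -lt0n; apply: leq_ltn_trans (big i iA).
    move=> _ /mapP[i + ->]; rewrite mem_enum mem_iota => iA.
    by have := big _ iA; have := kn i; lia.
  by rewrite size_map size_iota -cardE cA ltnn.
have cAi : #|A :\ i|%SET = j by have := cardsD1 i A; rewrite iA cA; lia.
have jn : (j <= n)%N.
  by rewrite -ltnS -cA; apply: leq_trans Tn; exact: max_card.
have := IH _ (introT eqP cAi).
have ki' : x i <= n%:R - j%:R by rewrite xk -natrB// ler_nat.
rewrite [setsum x A]/setsum (big_setD1 _ iA) /= -/(setsum x _).
have -> : top_sum n%:R j.+1 = top_sum n%:R j + (n%:R - j%:R) :> R.
  by rewrite /top_sum mulrSr; field.
by move=> ?; lra.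
Qed.

End vectors.

Section hull.
Context {R : realType}.

Local Open Scope classical_set_scope.

Lemma setsum_row m (x y : 'rV[R]_m) (a b : R) A :
  setsum ((a *: x + b *: y) ord0) A = a * setsum (x ord0) A + b * setsum (y ord0) A.
Proof.
rewrite /setsum !big_distrr -big_split /=.
by apply: eq_bigr => i _; rewrite !mxE.
Qed.

Lemma convex_polymatroid m t :
  convex_set [set x : 'rV[R]_m | in_polymatroid (x ord0) t].
Proof.
move=> x y p; rewrite !inE /= => -[x0 xP] [y0 yP].
rewrite /conv /= /unstable.onem; set a := p%:num.
have a0 : 0 <= a by exact: (ge0 p).
have a1 : 0 <= 1 - a by rewrite subr_ge0; exact: (le1 p).
split=> [i|A]; first by rewrite !mxE; apply: addr_ge0; apply: mulr_ge0.
rewrite setsum_row.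
have := ler_wpM2l a0 (xP A); have := ler_wpM2l a1 (yP A); lra.
Qed.

Lemma convex_hull_convex m (A : set 'rV[R]_m) : convex_set (convex_hull A).
Proof.
move=> x y p; rewrite !inE => xA yA X [cX AX].
have xX : X x := xA X (conj cX AX).
have yX : X y := yA X (conj cX AX).
by have := cX x y p (mem_set xX) (mem_set yX); rewrite inE.
Qed.

Lemma partial_permutohedronE m n : (m <= n.+1)%N ->
  @partial_permutohedron R m n = [set x | in_polymatroid (x ord0) n%:R].
Proof.
move=> mn; have Tn : (#|'I_m| <= n.+1)%N by rewrite card_ord.
apply/seteqP; split.
  apply: smallest_sub; first exact: convex_polymatroid.
  by move=> x [xn xinj]; exact: partial_perm_in_polymatroid.
pose s (c : 'I_m + {set 'I_m}) (x : 'rV[R]_m) : R := match c with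
  | inl i => x ord0 i | inr A => top_sum n%:R #|A| - setsum (x ord0) A end.
pose l (c : 'I_m + {set 'I_m}) (d : 'rV[R]_m) : R := match c with
  | inl i => d ord0 i | inr A => - setsum (d ord0) A end.
have sP (x : 'rV[R]_m) : in_polymatroid (x ord0) n%:R <-> forall c, 0 <= s c x.
  split=> [[x0 xP] [i|A] /=|H]; [exact: x0|by rewrite subr_ge0|].
  by split=> [i|A]; [exact: (H (inl i))|have := H (inr A); rewrite /= subr_ge0].
have deltaE i k : (delta_mx ord0 i : 'rV[R]_m) ord0 k = (k == i)%:R.
  by rewrite mxE eqxx.
have delta_sum i A : setsum ((delta_mx ord0 i : 'rV[R]_m) ord0) A = (i \in A)%:R.
  rewrite /setsum (eq_bigr (fun k => (k == i)%:R)) => [|k _]; last exact: deltaE.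
  have [iA|iA] := boolP (i \in A).
    rewrite (bigD1 i)//= eqxx big1 ?addr0// => k /andP[_ /negPf ->//].
  by rewrite big1// => k kA; case: eqP => // ki; rewrite ki (negPf iA) in kA.
move=> x /sP; apply: (@polyhedron_sub_convex R 'rV[R]_m _ s l) => //.
- move=> [i|A] y d a /=; first by rewrite !mxE.
  by rewrite -[y in LHS]scale1r setsum_row; ring.
- exact: convex_hull_convex.
move=> {}x /[dup] x0 /sP xP.
have [[i [j [ij xi xj tight]]]|[i xi free]|xn] := vertex_or_edge Tn xP.
- right; exists (1 *: delta_mx ord0 i + (-1) *: delta_mx ord0 j); split.
  + move=> [k|A] /= sx.
      rewrite !mxE !eqxx /=; case: eqP => [ki|_]; first by rewrite -ki sx ltxx in xi.
      by case: eqP => [kj|_]; [rewrite -kj sx ltxx in xj|rewrite !mulr0 addr0].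
    rewrite setsum_row !delta_sum tight ?mulN1r ?mul1r ?subrr ?oppr0//.
    by move/eqP: sx; rewrite subr_eq0 eq_sym.
  + exists (inl j); rewrite /= !mxE !eqxx /= [j == i]eq_sym (negPf ij) /= mulr0 add0r mulr1 oppr_lt0//.
  + exists (inl i); rewrite /= !mxE !eqxx /= (negPf ij) /= mulr0 addr0 mulr1//.
- right; exists (delta_mx ord0 i); split.
  + move=> [k|A] /= sx.
      by rewrite deltaE; case: eqP => // ki; rewrite -ki sx ltxx in xi.
    rewrite delta_sum (negPf (free A _)) ?oppr0//.
    by move/eqP: sx; rewrite subr_eq0 eq_sym.
  + by exists (inr [set i]%SET); rewrite /= delta_sum finset.set11 oppr_lt0.
  + by exists (inl i); rewrite /= deltaE eqxx.
- by left; apply: sub_gen_smallest; exact: xn.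
Qed.

End hull.

(** * Splitting tuples along a subset of the coordinates *)

Definition subtuple (T : Type) k m (a : 'I_k -> 'I_m) (x : m.-tuple T) : k.-tuple T :=
  [tuple tnth x (a i) | i < k].

Lemma tnth_subtuple T k m (a : 'I_k -> 'I_m) (x : m.-tuple T) i :
  tnth (subtuple a x) i = tnth x (a i).
Proof. exact: tnth_mktuple. Qed.

Lemma tnth_cons_pair0 (T : Type) m (x : T) (t : m.-tuple T) :
  tnth (cons_pair (x, t)) ord0 = x.
Proof. exact: tnth0. Qed.

Lemma tnth_cons_pairS (T : Type) m (x : T) (t : m.-tuple T) i :
  tnth (cons_pair (x, t)) (lift ord0 i) = tnth t i.
Proof. exact: tnthS. Qed.

Lemma subtuple_cons (T : Type) m (x : m.+1.-tuple T) :
  x = cons_pair (tnth x ord0, subtuple (lift ord0) x).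
Proof.
apply: eq_from_tnth => i; have [j ->|->] := unliftP ord0 i.
  by rewrite tnth_cons_pairS tnth_subtuple.
by rewrite tnth_cons_pair0.
Qed.

Section subtuples.
Import boot.finset.
Context {R : realType}.
Implicit Types (t : R).

Lemma setsum_subtuple k m (a : 'I_k -> 'I_m) (x : m.-tuple R) B :
  injective a -> setsum (tnth (subtuple a x)) B = setsum (tnth x) (a @: B).
Proof.
move=> a_inj; rewrite /setsum big_imset; last by move=> i j _ _; exact: a_inj.
by apply: eq_bigr => i _; rewrite tnth_subtuple.
Qed.

(** By symmetry of the permutohedron of t, t - 1, ..., t - k, forgetting one of its
k + 1 coordinates y gives this polytope: the lower bounds are the upper bounds on
the complementary sums that contain the forgotten coordinate. *)
Definition in_block k t (y : k.-tuple R) := forall B : {set 'I_k},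
  bottom_sum t k #|B| <= setsum (tnth y) B <= top_sum t #|B|.

(** Extends a so that it also selects the head coordinate, in the first position. *)
Definition head_tail k m (a : 'I_k -> 'I_m) (i : 'I_k.+1) : 'I_m.+1 :=
  if unlift ord0 i is Some j then lift ord0 (a j) else ord0.

Definition tail m (x : m.+1.-tuple R) : m.-tuple R := subtuple (lift ord0) x.

Lemma enum_val_imset (T : finType) (S A : {set T}) : A \subset S ->
  exists B : {set 'I_#|S|}, A = [set enum_val i | i in B].
Proof.
move=> AS; exists [set i | enum_val i \in A]; apply/setP => i.
apply/idP/imsetP => [iA|[j]]; last by rewrite inE => ? ->.
have iS := fintype.subsetP AS _ iA.
by exists (enum_rank_in iS i); rewrite ?inE enum_rankK_in.
Qed.

Lemma split_at_subtuple m t (x : m.-tuple R) (S : {set 'I_m}) :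
  split_at (tnth x) t S <->
  in_block t (subtuple (enum_val (A := S)) x) /\
  in_polymatroid (tnth (subtuple (enum_val (A := ~: S)) x)) (t - #|S|.+1%:R).
Proof.
have sub (U : {set 'I_m}) (B : {set 'I_#|U|}) : enum_val @: B \subset U.
  by apply/fintype.subsetP => _ /imsetP[i _ ->]; exact: enum_valP.
split=> [[xS [x0 xC]]|[xS [x0 xC]]]; split.
- move=> B; rewrite setsum_subtuple; last exact: enum_val_inj.
  by have := xS _ (sub _ B); rewrite card_imset//; exact: enum_val_inj.
- split => [i|B].
    by rewrite tnth_subtuple x0//; have := enum_valP i; rewrite inE.
  rewrite setsum_subtuple; last exact: enum_val_inj.
  by have := xC _ (sub _ B); rewrite card_imset//; exact: enum_val_inj.
- move=> A /enum_val_imset[B ->].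
  by have := xS B; rewrite setsum_subtuple ?card_imset//; exact: enum_val_inj.
- split=> [i iS|A /enum_val_imset[B ->]].
    have iC : i \in ~: S by rewrite inE.
    by have := x0 (enum_rank_in iC i); rewrite tnth_subtuple enum_rankK_in.
  by have := xC B; rewrite setsum_subtuple ?card_imset//; exact: enum_val_inj.
Qed.

(** The selections of the coordinates in S and outside S are jointly bijective, the
form required by [lebesgue_tuple_split]. *)
Lemma enum_val_split (T : finType) (S : {set T}) :
  bijective (fun s : 'I_#|S| + 'I_#|~: S| =>
    match s with inl i => enum_val i | inr j => enum_val j end).
Proof.
apply: inj_card_bij; last by rewrite card_sum !card_ord cardsC.
move=> [i|i] [j|j] ij.
- by congr inl; exact: enum_val_inj.
- by have := enum_valP j; rewrite inE -ij enum_valP.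
- by have := enum_valP i; rewrite inE ij enum_valP.
- by congr inr; exact: enum_val_inj.
Qed.

Lemma head_tail_split k l m (a : 'I_k -> 'I_m) (b : 'I_l -> 'I_m) :
  bijective (fun s => match s with inl i => a i | inr j => b j end) ->
  bijective (fun s => match s with inl i => head_tail a i
    | inr j => lift ord0 (b j) end).
Proof.
move=> abij; have ab_inj := bij_inj abij.
have klm : (k + l)%N = m.
  by have := bij_eq_card abij; rewrite card_sum !card_ord.
apply: inj_card_bij; last by rewrite card_sum !card_ord -klm.
rewrite /head_tail => -[i|i] [j|j].
- case: (unliftP ord0 i) => [i' ->|->]; case: (unliftP ord0 j) => [j' ->|->] //.
  by move=> /lift_inj /(ab_inj (inl i') (inl j')) [->].
- case: (unliftP ord0 i) => [i' ->|->] //.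
  by move=> /lift_inj /(ab_inj (inl i') (inr j)).
- case: (unliftP ord0 j) => [j' ->|->] //.
  by move=> /lift_inj /(ab_inj (inr i) (inl j')).
- by move=> /lift_inj /(ab_inj (inr i) (inr j)) [->].
Qed.

Lemma tnth_head_tail0 k m (a : 'I_k -> 'I_m) (x : m.+1.-tuple R) :
  tnth (subtuple (head_tail a) x) ord0 = tnth x ord0.
Proof. by rewrite tnth_subtuple /head_tail unlift_none. Qed.

Lemma tail_head_tail k m (a : 'I_k -> 'I_m) (x : m.+1.-tuple R) :
  tail (subtuple (head_tail a) x) = subtuple a (tail x).
Proof.
by apply: eq_from_tnth => i; rewrite !tnth_subtuple /head_tail liftK.
Qed.

(** A constraint on a set containing the head is a bound on the head by the slack
of the rest of that set. *)
Lemma polymatroid_tail m t (x : m.+1.-tuple R) :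
  in_polymatroid (tnth x) t <->
  [/\ in_polymatroid (tnth (tail x)) t, 0 <= tnth x ord0 &
      forall A, tnth x ord0 <= slack (tnth (tail x)) t A].
Proof.
have l_inj : injective (lift (ord0 : 'I_m.+1)) by exact: lift_inj.
have l0 (A : {set 'I_m}) : ord0 \notin lift ord0 @: A.
  by apply/imsetP => -[j _ /eqP]; rewrite eq_liftF.
split=> [[x0 xP]|[[x0 xP] h0 hP]].
- split => // [|A]; first split => [i|A].
  + by rewrite tnth_subtuple.
  + by rewrite setsum_subtuple// -(card_imset _ l_inj).
  + rewrite /slack setsum_subtuple//; have := xP (ord0 |: lift ord0 @: A).
    by rewrite cardsU1 l0 card_imset// /setsum big_setU1//=; lra.
- split=> [i|A].
    by have [j ->|-> //] := unliftP ord0 i; have := x0 j; rewrite tnth_subtuple.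
  pose B := [set j | lift ord0 j \in A].
  have AB : A :\ ord0 = lift ord0 @: B.
    apply/setP => i; rewrite !inE; apply/andP/imsetP => [[i0 iA]|[j]].
      have [j ij|i0'] := unliftP ord0 i; last by rewrite i0' eqxx in i0.
      by exists j => //; rewrite inE -ij.
    by rewrite inE => jA ->; split => //; rewrite eq_sym eq_liftF.
  have [A0|A0] := boolP (ord0 \in A).
    rewrite -(setD1K A0) AB cardsU1 l0 card_imset// /setsum big_setU1//=.
    by have := hP B; rewrite /slack setsum_subtuple// /setsum; lra.
  have -> : A = lift ord0 @: B.
    rewrite -AB; apply/setP => i; rewrite !inE andb_idl// => iA.
    by apply: contraNneq A0 => <-.
  by rewrite card_imset// -setsum_subtuple.
Qed.

(** Any minimizer of the slack serves as S. *)
Lemma polymatroid_split m t (x : m.-tuple R) : m%:R <= t ->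
  in_polymatroid (tnth x) t <-> exists S, split_at (tnth x) t S.
Proof.
move=> mt; split=> [xP|[S xS]].
  exists [arg min_(S < set0) slack (tnth x) t S]%O.
  apply: minimizer_split_at => // A.
  by case: arg_minP => // S _; apply.
apply: split_at_polymatroid xS; apply: le_trans mt.
by rewrite ler_nat -[leqRHS]card_ord max_card.
Qed.

Lemma polymatroid_split_tail m t (x : m.+1.-tuple R) : m%:R <= t ->
  in_polymatroid (tnth x) t <-> exists S,
   [/\ split_at (tnth (tail x)) t S, 0 <= tnth x ord0 &
       tnth x ord0 <= slack (tnth (tail x)) t S].
Proof.
move=> mt; rewrite polymatroid_tail; split=> [[xP x0 xA]|[S [xS x0 xA]]].
  exists [arg min_(S < set0) slack (tnth (tail x)) t S]%O.
  split=> //; apply: minimizer_split_at => // A.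
  by case: arg_minP => // S _; apply.
split=> // [|A]; first by apply/polymatroid_split => //; exists S.
exact: le_trans (split_at_minimizer xS A).
Qed.

End subtuples.

(** * Lebesgue measure on tuples *)

Section boxes.
Local Open Scope classical_set_scope.
Context {R : realType}.
Local Notation RT := (measurableTypeR R).

Definition box m (A : 'I_m -> set RT) : set (m.-tuple RT) :=
  [set x | forall i, A i (tnth x i)].

Lemma measurable_box m (A : 'I_m -> set RT) :
  (forall i, measurable (A i)) -> measurable (box A).
Proof.
move=> mA; rewrite [X in measurable X](_ : _ = \bigcap_(i in [set: 'I_m])
    ((fun t : m.-tuple RT => tnth t i) @^-1` A i)); last first.
  by apply/seteqP; split => t /= H i => [_|]; exact: H.
apply: fin_bigcap_measurable => // i _.
rewrite -[X in measurable X]setTI; exact: measurable_tnth.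
Qed.

Lemma measurable_tuple_boxes m :
  @measurable _ (m.-tuple RT) =
  <<s [set box A | A in [set A : 'I_m -> set RT | forall i, measurable (A i)]] >>.
Proof.
apply/seteqP; split.
- apply: smallest_sub; first exact: smallest_sigma_algebra.
  move=> X; rewrite -bigcup_seq => -[i _ [B mB <-]].
  apply: sub_sigma_algebra.
  exists (fun j => if j == i then B else setT) => [j|]; first by case: ifP.
  rewrite setTI; apply/seteqP; split => x /=.
    by move=> /(_ i); rewrite eqxx.
  by move=> Bx j; case: eqP => // ->.
- apply: smallest_sub; first exact: sigma_algebra_measurable.
  by move=> _ [A mA <-]; exact: measurable_box.
Qed.

(** Boxes form a pi-system that generates the sigma-algebra of tuples, and the cubes
with side [-k, k] exhaust the space with finite measure. *)
Lemma lebesgue_tuple_unique m (nu : {measure set (m.-tuple RT) -> \bar R}) :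
  (forall A, (forall i, measurable (A i)) ->
    nu (box A) = (\prod_(i < m) lebesgue_measure (A i))%E) ->
  forall X, measurable X -> @lebesgue_tuple R m X = nu X.
Proof.
move=> nuE X mX.
pose g k : set (m.-tuple RT) :=
  box (fun=> [set` `[- (k%:R : R), k%:R]%R] : set RT).
apply: (@measure_unique _ _ _ _ g (measurable_tuple_boxes m)) => //.
- move=> _ _ [A mA <-] [B mB <-].
  exists (fun i => A i `&` B i) => [i|]; first exact: measurableI.
  apply/seteqP; split => x /= => [H|[HA HB] i]; last by split.
  by split => i; have [] := H i.
- by move=> k; exists (fun=> [set` `[- (k%:R : R), k%:R]%R]).
- apply/seteqP; split => // x _.
  exists (Num.truncn (\sum_(i < m) `|tnth x i|)).+1 => // i /=.
  rewrite in_itv /= -ler_norml; apply/ltW.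
  apply: le_lt_trans (truncnS_gt _).
  rewrite (bigD1 i) //= lerDl; exact: sumr_ge0.
- move=> _ [A mA <-]; rewrite nuE//; exact: lebesgue_tuple_box.
- move=> k; rewrite [X in (X < _)%E]lebesgue_tuple_box//.
  rewrite lebesgue_measure_itv /= lte_fin -(fun_if EFin) prodEFin; exact: ltry.
Qed.

Lemma measurable_subtuple k m (a : 'I_k -> 'I_m) :
  measurable_fun setT (@subtuple RT k m a).
Proof.
apply/measurable_fun_tnthP => i.
rewrite (_ : _ \o _ = fun x => tnth x (a i)); first exact: measurable_tnth.
by apply/funext => x /=; rewrite tnth_subtuple.
Qed.

Definition merge_tuple (T : Type) k l m (d : 'I_m -> 'I_k + 'I_l)
    (yz : k.-tuple T * l.-tuple T) : m.-tuple T :=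
  [tuple match d i with inl a => tnth yz.1 a | inr b => tnth yz.2 b end | i < m].

Lemma measurable_merge_tuple k l m (d : 'I_m -> 'I_k + 'I_l) :
  measurable_fun setT (@merge_tuple RT k l m d).
Proof.
apply/measurable_fun_tnthP => i.
rewrite (_ : _ \o _ = fun yz : k.-tuple RT * l.-tuple RT =>
  match d i with inl a => tnth yz.1 a | inr b => tnth yz.2 b end); last first.
  by apply/funext => x /=; rewrite tnth_mktuple.
case: (d i) => [a|b].
  by apply: (measurableT_comp (measurable_tnth a)); exact: measurable_fst.
by apply: (measurableT_comp (measurable_tnth b)); exact: measurable_snd.
Qed.

(** Both invariance under permutations of the coordinates and the product formula,
in one statement: the two groups of coordinates may be interleaved arbitrarily.
It suffices to compare the measures of boxes. *)
Lemma lebesgue_tuple_split k l m (a : 'I_k -> 'I_m) (b : 'I_l -> 'I_m)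
    (d : 'I_m -> 'I_k + 'I_l)
    (E : set (k.-tuple RT)) (F : set (l.-tuple RT)) :
  cancel (fun s => match s with inl i => a i | inr j => b j end) d ->
  cancel d (fun s => match s with inl i => a i | inr j => b j end) ->
  measurable E -> measurable F ->
  @lebesgue_tuple R m [set x | E (subtuple a x) /\ F (subtuple b x)] =
  (@lebesgue_tuple R k E * @lebesgue_tuple R l F)%E.
Proof.
move=> abK dK mE mF; set X := [set x | _].
have mX : measurable X.
  apply: measurableI; rewrite -[X in measurable X]setTI;
  exact: measurable_subtuple.
have mm : measurable_fun setT (@merge_tuple RT k l m d)
  by exact: measurable_merge_tuple.
rewrite (@lebesgue_tuple_unique m (pushforward
   (product_measure1 (@lebesgue_tuple R k) (@lebesgue_tuple R l))
   (@merge_tuple RT k l m d)))//.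
- rewrite /= /pushforward -product_measure1E//; congr product_measure1.
  have Ka yz : subtuple a (merge_tuple d yz) = yz.1.
    apply: eq_from_tnth => i; rewrite tnth_subtuple tnth_mktuple.
    by rewrite (abK (inl i)).
  have Kb yz : subtuple b (merge_tuple d yz) = yz.2.
    apply: eq_from_tnth => i; rewrite tnth_subtuple tnth_mktuple.
    by rewrite (abK (inr i)).
  by rewrite /X; apply/seteqP; split => yz /=; rewrite Ka Kb.
- move=> A mA; rewrite /= /pushforward.
  rewrite (_ : _ @^-1` _ = box (fun i => A (a i)) `*` box (fun i => A (b i))).
    rewrite product_measure1E; [|exact: measurable_box..].
    rewrite [X in (X * _)%E]lebesgue_tuple_box// [X in (_ * X)%E]lebesgue_tuple_box//.
    rewrite (reindex (fun s => match s with inl i => a i | inr j => b j end)) /=.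
      by rewrite big_sumType.
    by exists d => i _; [exact: abK|exact: dK].
  apply/seteqP; split => yz /= => [H|[H1 H2] i].
    by split => i; [have := H (a i)|have := H (b i)];
      rewrite tnth_mktuple ?(abK (inl i)) ?(abK (inr i)).
  rewrite tnth_mktuple; have := dK i; case: (d i) => j <-; [exact: H1|exact: H2].
Qed.

Definition reflect_tuple (c : R) m (x : m.-tuple RT) : m.-tuple RT :=
  [tuple c - tnth x i | i < m].
Arguments reflect_tuple c {m} x.

Lemma measurable_subl (c : R) : measurable_fun setT (fun x : RT => c - x : RT).
Proof.
apply: (@measurable_funB _ _ R setT (cst c) id); first exact: measurable_cst.
exact: measurable_id.
Qed.

Lemma lebesgue_measure_reflect (c : R) (A : set RT) : measurable A ->
  lebesgue_measure ((fun x : RT => c - x : RT) @^-1` A) = lebesgue_measure A.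
Proof.
have mc := measurable_subl c.
move=> mA.
rewrite -[LHS]/(pushforward lebesgue_measure (fun x : RT => c - x : RT) A).
apply/esym/lebesgue_measure_unique => //= _ [[p q]] _ <-.
rewrite /pushforward [X in (_ = lebesgue_measure X)%E](_ : _ = [set` `[c - q, c - p[%R]).
  by rewrite !lebesgue_measure_itv /= !lte_fin ltrD2l ltrN2; case: ifP => // _;
    congr (_%:E); ring.
by apply/seteqP; split => x /=; rewrite !in_itv /= => /andP[? ?]; apply/andP; split; lra.
Qed.

Lemma measurable_reflect_tuple c m : measurable_fun setT (@reflect_tuple c m).
Proof.
apply/measurable_fun_tnthP => i.
rewrite (_ : _ \o _ = fun x => c - tnth x i : RT); last first.
  by apply/funext => x /=; rewrite tnth_mktuple.
exact: (measurableT_comp (measurable_subl c) (measurable_tnth i)).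
Qed.

Lemma lebesgue_tuple_reflect c m (X : set (m.-tuple RT)) : measurable X ->
  @lebesgue_tuple R m (reflect_tuple c @^-1` X) = @lebesgue_tuple R m X.
Proof.
have mr := @measurable_reflect_tuple c m.
move=> mX.
rewrite -[LHS]/(pushforward (@lebesgue_tuple R m) (reflect_tuple c) X).
apply/esym/lebesgue_tuple_unique => //= A mA.
rewrite /pushforward -(eq_bigr _ (fun i _ => lebesgue_measure_reflect c (mA i))).
rewrite -lebesgue_tuple_box => [|i].
  by congr lebesgue_tuple; apply/seteqP; split => x /= H i; have := H i;
    rewrite tnth_mktuple.
by rewrite -[X in measurable X]setTI; exact: measurable_subl.
Qed.

End boxes.
Arguments reflect_tuple {R} c {m} x.

Section hyperplanes.
Local Open Scope classical_set_scope.
Context {R : realType}.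
Local Notation RT := (measurableTypeR R).

Definition linform m (a : 'I_m -> R) (x : m.-tuple RT) : R :=
  \sum_(i < m) a i * tnth x i.

Lemma linform_cons m (a : 'I_m.+1 -> R) y (x : m.-tuple RT) :
  linform a (cons_pair (y, x)) =
  a ord0 * y + linform (fun i => a (lift ord0 i)) x.
Proof.
rewrite /linform big_ord_recl tnth_cons_pair0; congr (_ + _).
by apply: eq_bigr => i _; rewrite tnth_cons_pairS.
Qed.

Lemma measurable_linform m (a : 'I_m -> R) :
  measurable_fun [set: m.-tuple RT] (linform a).
Proof.
apply: measurable_sum => i; apply: measurable_funM; first exact: measurable_cst.
exact: measurable_tnth.
Qed.

Lemma measurable_hyperplane m (a : 'I_m -> R) c :
  measurable [set x : m.-tuple RT | linform a x = c].
Proof.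
rewrite -[X in measurable X]setTI.
exact: (measurable_linform a measurableT (measurable_set1 c)).
Qed.

(** If a coordinate of the tail has a nonzero coefficient, every section with fixed
head is again a hyperplane; otherwise the set is a point times a full space. *)
Lemma hyperplane_null m (a : 'I_m -> R) c : (exists i, a i != 0) ->
  @lebesgue_tuple R m [set x | linform a x = c] = 0%E.
Proof.
elim: m => [|m IH] in a c *; first by case=> -[].
move=> aN0; have [[j aj]|a0] := pselect (exists j, a (lift ord0 j) != 0).
- rewrite /= /pushforward /product_measure1; apply: integral0_eq => y _ /=.
  rewrite [X in lebesgue_tuple X](_ : _ =
    [set x | linform (fun j => a (lift ord0 j)) x = c - a ord0 * y]).
    by apply: IH; exists j.
  rewrite /xsection; apply/seteqP; split => x /=;
    rewrite inE /= linform_cons => H; lra.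
- have {}a0 j : a (lift ord0 j) = 0.
    by apply/eqP; apply: contrapT => /negP aj; apply: a0; exists j.
  have a00 : a ord0 != 0.
    have [i] := aN0; have [j ->|-> //] := unliftP ord0 i; first by rewrite a0 eqxx.
  rewrite /= /pushforward [X in product_measure1 _ _ X](_ : _ =
     [set c / a ord0] `*` setT).
    have m1 : measurable ([set c / a ord0] : set RT) by exact: measurable_set1.
    rewrite (product_measure1E _ _ m1 measurableT).
    by have /= -> := lebesgue_measure_set1 (c / a ord0); rewrite mul0e.
  have lin0 x : linform (fun j => a (lift ord0 j)) x = 0.
    by apply: big1 => i _; rewrite a0 mul0r.
  apply/seteqP; split => -[y x] /=; rewrite linform_cons lin0 addr0.
    by move=> <-; rewrite mulrAC mulfV ?mul1r.
  by case=> -> _; rewrite mulrCA mulfV ?mulr1.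
Qed.

End hyperplanes.

Section null_overlaps.
Local Open Scope classical_set_scope.

Lemma measure_setDnull d (T : measurableType d) (R : realType)
    (mu : {measure set T -> \bar R}) (A N : set T) :
  measurable A -> measurable N -> mu N = 0%E -> mu (A `\` N) = mu A.
Proof.
move=> mA mN N0; rewrite [RHS](measureDI _ mA mN).
rewrite [X in _ = (_ + X)%E](_ : _ = 0%E) ?adde0//.
by apply: (subset_measure0 _ mN _ N0); [exact: measurableI|exact: subIsetr].
Qed.

Lemma measure_bigcup_null d (T : measurableType d) (R : realType)
    (mu : {measure set T -> \bar R}) (I : finType) (C : I -> set T) :
  (forall i, measurable (C i)) ->
  (forall i j, i != j -> mu (C i `&` C j) = 0%E) ->
  mu (\bigcup_(i in [set: I]) C i) = (\sum_i mu (C i))%E.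
Proof.
move=> mC CC0.
(* Off the union N of the overlaps, the sets are disjoint. *)
pose N := \big[setU/set0]_(p : I * I | p.1 != p.2) (C p.1 `&` C p.2).
have mN : measurable N.
  by apply: bigsetU_measurable => -[i j] _; exact: measurableI.
have N0 : mu N = 0%E.
  apply: measure_negligible => //; rewrite /N.
  elim/big_ind: _ => [|A B|[i j] /= ij]; first exact: negligible_set0.
    exact: negligibleU.
  by apply/negligibleP; [exact: measurableI|exact: CC0].
have mU : measurable (\bigcup_(i in [set: I]) C i).
  exact: fin_bigcup_measurable.
rewrite -(measure_setDnull mU mN N0) setD_bigcupl measure_fin_bigcup//.
- rewrite [RHS]fsbig_seq ?index_enum_uniq//.
  rewrite (_ : [set` _] = [set: I]).
    by apply: eq_fsbigr => i _; exact: measure_setDnull.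
  by apply/seteqP; split => i //= _; rewrite mem_index_enum.
- exact: finite_finset.
- apply/trivIsetP => i j _ _ ij; apply/seteqP; split => // x /= [[Ci nN] [Cj _]].
  apply: nN; rewrite /N -bigcup_seq_cond.
  by exists (i, j) => //=; rewrite mem_index_enum.
- by move=> i _; exact: measurableD.
Qed.

End null_overlaps.

(** * Blocks and their volumes *)

Section volumes.
Local Open Scope classical_set_scope.
Context {R : realType}.
Local Notation RT := (measurableTypeR R).
Local Notation mu := (@lebesgue_tuple R _).
Implicit Types (t : R).

Lemma measurable_forall d (T : measurableType d) (I : finType) (F : I -> set T) :
  (forall i, measurable (F i)) -> measurable [set x | forall i, F i x].
Proof.
move=> mF; rewrite (_ : [set x | _] = \bigcap_(i in [set: I]) F i).
  exact: fin_bigcap_measurable.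
by apply/seteqP; split => x /= H i => [_|]; exact: H.
Qed.

Lemma measurable_le d (T : measurableType d) (f g : T -> R) :
  measurable_fun setT f -> measurable_fun setT g ->
  measurable [set x | f x <= g x].
Proof.
move=> mf mg; rewrite -[X in measurable X]setTI.
exact: (measurable_fun_ler mf mg measurableT (Y := [set true])).
Qed.

Lemma setsum_linform m (x : m.-tuple RT) (A : {set 'I_m}) :
  setsum (tnth x) A = linform (fun i => (i \in A)%:R) x.
Proof.
rewrite /setsum /linform big_mkcond; apply: eq_bigr => i _.
by case: ifP; rewrite ?mul1r ?mul0r.
Qed.

Lemma measurable_setsum m (A : {set 'I_m}) :
  measurable_fun setT (fun x : m.-tuple RT => setsum (tnth x) A).
Proof.
under eq_fun do rewrite setsum_linform.
exact: measurable_linform.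
Qed.

Definition polymatroid m t : set (m.-tuple RT) :=
  [set x | in_polymatroid (tnth x) t].

Definition block k t : set (k.-tuple RT) := [set y | in_block t y].

(** The block together with its forgotten coordinate g(y), as the region
0 <= y0 <= g(y) under the graph of g. *)
Definition tall_block k t : set (k.+1.-tuple RT) :=
  [set y | [/\ in_block t (tail y), 0 <= tnth y ord0 &
    setsum (tnth y) [set: 'I_k.+1]%SET <= top_sum t k.+1]].

Arguments polymatroid : clear implicits.
Arguments block : clear implicits.
Arguments tall_block : clear implicits.

Lemma measurable_polymatroid m t : measurable (polymatroid m t).
Proof.
apply: measurableI; apply: measurable_forall => i; apply: measurable_le.
- exact: measurable_cst.
- exact: measurable_tnth.
- exact: measurable_setsum.
- exact: measurable_cst.
Qed.

Lemma measurable_block k t : measurable (block k t).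
Proof.
apply: measurable_forall => A.
rewrite [X in measurable X](_ : _ = [set y | bottom_sum t k #|A| <= setsum (tnth y) A] `&`
    [set y | setsum (tnth y) A <= top_sum t #|A|]).
  apply: measurableI; apply: measurable_le;
    solve [exact: measurable_cst|exact: measurable_setsum].
by apply/seteqP; split => y /= => [/andP[]|[-> ->]].
Qed.

Lemma measurable_tail m : measurable_fun setT (@tail R m : _ -> m.-tuple RT).
Proof. exact: measurable_subtuple. Qed.

Lemma measurable_tall_block k t : measurable (tall_block k t).
Proof.
rewrite (_ : tall_block k t = (@tail R k : _ -> k.-tuple RT) @^-1` block k t `&`
   ([set y | 0 <= tnth y ord0] `&` [set y | setsum (tnth y) [set: 'I_k.+1]%SET <= top_sum t k.+1])).
  apply: measurableI; last apply: measurableI.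
  - rewrite -[X in measurable X]setTI.
    by apply: measurable_tail => //; exact: measurable_block.
  - by apply: measurable_le; [exact: measurable_cst|exact: measurable_tnth].
  - by apply: measurable_le; [exact: measurable_setsum|exact: measurable_cst].
by apply/seteqP; split => y /= => [[]|[? []]].
Qed.

Lemma bounded_fin_num m (X : set (m.-tuple RT)) c : measurable X ->
  (forall x, X x -> forall i, `|tnth x i| <= c) -> mu X \is a fin_num.
Proof.
move=> mX Xc.
have Xb : X `<=` box (fun=> [set` `[- c, c]%R] : set RT).
  move=> x Xx i; suff: tnth x i \in `[- c, c]%R by [].
  by rewrite in_itv /= -ler_norml Xc.
rewrite ge0_fin_numE//; apply: le_lt_trans (le_measure _ _ _ Xb) _; rewrite ?inE//.
  exact: measurable_box.
rewrite [X in (X < _)%E]lebesgue_tuple_box//.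
rewrite lebesgue_measure_itv /= lte_fin -(fun_if EFin) prodEFin; exact: ltry.
Qed.

Lemma top_sum1 t : top_sum t 1 = t. Proof. by rewrite /top_sum; field. Qed.
Lemma bottom_sum1 t k : bottom_sum t k 1 = t - k%:R. Proof. by rewrite /bottom_sum; field. Qed.
Lemma setsum1 (T : finType) (x : T -> R) i : setsum x [set i]%SET = x i.
Proof. by rewrite /setsum big_set1. Qed.

Lemma setsumT (T : finType) (x : T -> R) : setsum x [set: T]%SET = \sum_i x i.
Proof. by apply: eq_bigl => i; rewrite inE. Qed.

Lemma polymatroid_fin_num m t : mu (polymatroid m t) \is a fin_num.
Proof.
apply: (@bounded_fin_num _ _ t); first exact: measurable_polymatroid.
move=> x [x0 xP] i; rewrite ger0_norm//.
by have := xP [set i]%SET; rewrite setsum1 cards1 top_sum1.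
Qed.

Lemma block_fin_num k t : mu (block k t) \is a fin_num.
Proof.
apply: (@bounded_fin_num _ _ (`|t| + k%:R)); first exact: measurable_block.
move=> x xP i; have := xP [set i]%SET; rewrite setsum1 cards1 top_sum1 bottom_sum1.
have := ler_norm t; have := ler_norm (- t); rewrite normrN => ? ? /andP[? ?].
by rewrite ler_norml; apply/andP; split; have : 0 <= k%:R :> R by []; lra.
Qed.

Lemma setsum_reflect k (y : k.-tuple RT) c (B : {set 'I_k}) :
  setsum (tnth (reflect_tuple c y)) B = #|B|%:R * c - setsum (tnth y) B.
Proof.
rewrite /setsum; under eq_bigr do rewrite tnth_mktuple.
by rewrite sumrB sumr_const mulr_natl.
Qed.

(** The reflection exchanges the two families of inequalities that define a block.
Allowing t and t' to differ, it gives both the central symmetry of a block and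
its invariance under translation. *)
Lemma reflect_block k t t' (y : k.-tuple RT) :
  in_block t y -> in_block t' (reflect_tuple (t + t' - k%:R) y).
Proof.
move=> yt B; rewrite setsum_reflect; have /andP[H1 H2] := yt B.
apply/andP; split; first by rewrite -(top_sum_reflect t); lra.
have := top_sum_reflect t' t k #|B|; rewrite [t' + t]addrC; lra.
Qed.

Lemma reflect_tupleK k c : involutive (@reflect_tuple R c k).
Proof. by move=> y; apply: eq_from_tnth => i; rewrite !tnth_mktuple subKr. Qed.

Lemma reflect_blockE k t t' :
  reflect_tuple (t + t' - k%:R) @^-1` block k t' = block k t.
Proof.
apply/seteqP; split => y /=; last exact: reflect_block.
by move/(@reflect_block _ _ t); rewrite [t' + t]addrC reflect_tupleK.
Qed.

(** A composition of reflections is a translation, but one reflection between the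
two blocks is enough. *)
Lemma block_translate k t t' : mu (block k t) = mu (block k t').
Proof.
by rewrite -(reflect_blockE k t t') lebesgue_tuple_reflect//; exact: measurable_block.
Qed.

Definition pvol m t : R := fine (mu (polymatroid m t)).
(** By [block_translate] this is the volume of the block for every t. *)
Definition bvol k : R := fine (mu (block k 0)).

Lemma polymatroid_vol m t : mu (polymatroid m t) = (pvol m t)%:E.
Proof. by rewrite fineK// polymatroid_fin_num. Qed.

Lemma block_vol k t : mu (block k t) = (bvol k)%:E.
Proof. by rewrite (block_translate k t 0) fineK// block_fin_num. Qed.

(** Put c = 2t - k.  The product of [0, c] with the block is cut in two by the graph
of the forgotten coordinate, and the reflection x |-> c - x in all k + 1
coordinates exchanges the two parts. *)
Lemma tall_block_vol k t : k%:R <= t ->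
  mu (tall_block k t) = (bvol k * (t - k%:R / 2))%:E.
Proof.
move=> kt; have k0 : 0 <= k%:R :> R by [].
have [c cE] : exists c, c = t + t - k%:R by eexists.
have c0 : 0 <= c by lra.
pose S := tall_block k t.
pose S' : set (k.+1.-tuple RT) := reflect_tuple c @^-1` S.
have mS : measurable S by exact: measurable_tall_block.
have mS' : measurable S'.
  by rewrite -[X in measurable X]setTI; exact: measurable_reflect_tuple.
have setsumS (y : k.+1.-tuple RT) : setsum (tnth y) [set: 'I_k.+1]%SET =
    tnth y ord0 + setsum (tnth (tail y)) [set: 'I_k]%SET.
  rewrite !setsumT big_ord_recl; congr (_ + _).
  by apply: eq_bigr => i _; rewrite tnth_subtuple.
have tail_reflect (y : k.+1.-tuple RT) : tail (reflect_tuple c y) = reflect_tuple c (tail y).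
  by apply: eq_from_tnth => i; rewrite !tnth_mktuple.
have capS : top_sum t k.+1 = k%:R * c - top_sum t k.+1 + c.
  by rewrite cE /top_sum mulrSr; field.
have S'E : S' = [set y | [/\ in_block t (tail y), tnth y ord0 <= c &
    top_sum t k.+1 <= setsum (tnth y) [set: 'I_k.+1]%SET]].
  apply/seteqP; split => y; rewrite /S' /S /tall_block /= tail_reflect tnth_mktuple
    setsum_reflect cardsT card_ord mulrSr; case=> yB y0 yS; split.
  - by move/(@reflect_block _ _ t): yB; rewrite -cE reflect_tupleK.
  - by lra.
  - by lra.
  - by rewrite cE; exact: reflect_block.
  - by lra.
  - by lra.
have SS' : \bigcup_(b in [set: bool]) (if b then S else S') =
    [set y | [/\ 0 <= tnth y ord0, tnth y ord0 <= c & in_block t (tail y)]].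
  rewrite S'E; apply/seteqP; split => y /=.
  - have capk : top_sum t k.+1 - top_sum t k = t - k%:R by rewrite /top_sum mulrSr; field.
    have := bottom_sumE t (leqnn k); rewrite subnn top_sum1 => lowk.
    have le_c (a s : R) : s <= top_sum t k -> bottom_sum t k k <= s ->
        a + s <= top_sum t k.+1 -> a <= c by lra.
    have ge_0 (a s : R) : s <= top_sum t k -> bottom_sum t k k <= s ->
        top_sum t k.+1 <= a + s -> 0 <= a by lra.
    case=> b _ yb; have yB : in_block t (tail y) by case: b yb => -[].
    have := yB [set: 'I_k]%SET; rewrite cardsT card_ord => /andP[yl yu].
    case: b yb => -[_ y0]; rewrite setsumS => yS.
      by split => //; exact: le_c yu yl yS.
    by split => //; exact: ge_0 yu yl yS.
  - case=> y0 yc yB; have [yS|/ltW yS] := leP (setsum (tnth y) [set: 'I_k.+1]%SET) (top_sum t k.+1).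
      by exists true.
    by exists false.
have S_S' : mu (S `&` S') = 0%E.
  pose H := [set y : k.+1.-tuple RT | linform (fun=> 1) y = top_sum t k.+1].
  apply: (@subset_measure0 _ _ _ _ _ H).
  - exact: measurableI.
  - exact: measurable_hyperplane.
  - rewrite S'E => y [[_ _ yS] [_ _ yS']]; rewrite /H /=.
    transitivity (setsum (tnth y) [set: 'I_k.+1]%SET).
      by rewrite setsumT; apply: eq_bigr => i _; rewrite mul1r.
    by apply/eqP; rewrite eq_le yS yS'.
  - by apply: hyperplane_null; exists ord0; rewrite oner_eq0.
have : mu (\bigcup_(b in [set: bool]) (if b then S else S')) = (mu S + mu S')%E.
  rewrite measure_bigcup_null ?big_bool// => [[]//|[] []//= _].
  by rewrite setIC.
rewrite {}SS' lebesgue_tuple_reflect//.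
rewrite [X in X = _ -> _](_ : _ = (c * bvol k)%:E); last first.
  rewrite /= /pushforward [X in product_measure1 _ _ X](_ : _ =
      [set` `[0, c]%R] `*` block k t).
    rewrite product_measure1E//; last exact: measurable_block.
    rewrite [X in (_ * X)%E]block_vol /= lebesgue_measure_itv /= lte_fin -EFinD subr0 EFinM.
    by case: ltrP => // c0'; congr (_%:E * _)%E; clear -c0 c0'; lra.
  apply/seteqP; split => -[x y] /=; rewrite tnth_cons_pair0 in_itv /=
    (_ : tail _ = y).
  - by case=> -> ->.
  - by apply: eq_from_tnth => i; rewrite tnth_subtuple tnth_cons_pairS.
  - by case=> /andP[].
  - by apply: eq_from_tnth => i; rewrite tnth_subtuple tnth_cons_pairS.
have : (0 <= mu S)%E by [].
case: (mu S) => [r _|//|//].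
rewrite -EFinD => -[cr]; congr (_%:E); have -> : r = c * bvol k / 2 by clear -cr; lra.
by rewrite cE; field.
Qed.

End volumes.

Arguments polymatroid {R} m t _.
Arguments block {R} k t _.
Arguments tall_block {R} k t _.

(** * The two volume recursions *)

Lemma sum_card_subsets (R : pzRingType) m (F : nat -> R) :
  \sum_(S : {set 'I_m}) F #|S| = \sum_(k < m.+1) 'C(m, k)%:R * F k.
Proof.
have lt_card (S : {set 'I_m}) : (#|S| < m.+1)%N.
  by rewrite ltnS -[leqRHS]card_ord max_card.
rewrite (partition_big (fun S : {set 'I_m} => Ordinal (lt_card S)) predT)//=.
apply: eq_bigr => k _; rewrite (eq_bigr (fun=> F k)) => [|S /eqP <-//].
rewrite sumr_const -[LHS]mulr_natl; congr (_ * _); congr (_%:R).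
have := card_draws 'I_m k; rewrite card_ord => <-.
by apply: eq_card => S; rewrite !inE.
Qed.

Section recursions.
Local Open Scope classical_set_scope.
Context {R : realType}.
Local Notation RT := (measurableTypeR R).
Local Notation mu := (@lebesgue_tuple R _).
Implicit Types (t : R).

Definition piece m t (S : {set 'I_m}) : set (m.-tuple RT) :=
  [set x | block #|S| t (subtuple (enum_val (A := S)) x) /\
    polymatroid #|~: S|%SET (t - #|S|.+1%:R)
      (subtuple (enum_val (A := ~: S)%SET) x)].

(** The part of the polymatroid in dimension m + 1 that lies above [piece]. *)
Definition tall_piece m t (S : {set 'I_m}) : set (m.+1.-tuple RT) :=
  [set x | tall_block #|S| t (subtuple (head_tail (enum_val (A := S))) x) /\
    polymatroid #|~: S|%SET (t - #|S|.+1%:R)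
      (subtuple (lift ord0 \o enum_val (A := ~: S)%SET) x)].

Lemma measurable_piece m t (S : {set 'I_m}) : measurable (piece t S).
Proof.
apply: measurableI; rewrite -[X in measurable X]setTI;
  apply: measurable_subtuple => //.
- exact: measurable_block.
- exact: measurable_polymatroid.
Qed.

Lemma measurable_tall_piece m t (S : {set 'I_m}) : measurable (tall_piece t S).
Proof.
apply: measurableI; rewrite -[X in measurable X]setTI;
  apply: measurable_subtuple => //.
- exact: measurable_tall_block.
- exact: measurable_polymatroid.
Qed.

Lemma card_setC_ord m (S : {set 'I_m}) : #|~: S|%SET = (m - #|S|)%N.
Proof. by have := cardsC S; rewrite card_ord; lia. Qed.

Lemma piece_vol m t (S : {set 'I_m}) :
  mu (piece t S) = (bvol #|S| * pvol (m - #|S|) (t - #|S|.+1%:R))%:E.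
Proof.
have [d abK dK] := enum_val_split S.
rewrite (lebesgue_tuple_split abK dK); last 2 first.
- exact: measurable_block.
- exact: measurable_polymatroid.
rewrite [X in (X * _)%E]block_vol [X in (_ * X)%E]polymatroid_vol.
by rewrite card_setC_ord.
Qed.

Lemma tall_piece_vol m t (S : {set 'I_m}) : m%:R <= t ->
  mu (tall_piece t S) = (bvol #|S| * (t - #|S|%:R / 2) *
     pvol (m - #|S|) (t - #|S|.+1%:R))%:E.
Proof.
move=> mt; have [d abK dK] := head_tail_split (enum_val_split S).
rewrite (lebesgue_tuple_split abK dK); last 2 first.
- exact: measurable_tall_block.
- exact: measurable_polymatroid.
rewrite [X in (X * _)%E]tall_block_vol; last first.
  by apply: le_trans mt; rewrite ler_nat -[leqRHS]card_ord max_card.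
rewrite [X in (_ * X)%E]polymatroid_vol.
by rewrite card_setC_ord.
Qed.

Lemma pieceP m t (S : {set 'I_m}) (x : m.-tuple RT) :
  piece t S x <-> split_at (tnth x) t S.
Proof. exact: iff_sym (split_at_subtuple t x S). Qed.

Lemma tall_pieceP m t (S : {set 'I_m}) (x : m.+1.-tuple RT) :
  tall_piece t S x <-> [/\ split_at (tnth (tail x)) t S, 0 <= tnth x ord0 &
       tnth x ord0 <= slack (tnth (tail x)) t S].
Proof.
have eqE : subtuple (lift ord0 \o enum_val (A := ~: S)%SET) x =
    subtuple (enum_val (A := ~: S)%SET) (tail x).
  by apply: eq_from_tnth => i; rewrite !tnth_subtuple.
have [spl1 spl2] := split_at_subtuple t (tail x) S.
rewrite /tall_piece /tall_block /mkset eqE tail_head_tail tnth_head_tail0.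
have -> : setsum (tnth (subtuple (head_tail (enum_val (A := S))) x)) [set: _]%SET
   = tnth x ord0 + setsum (tnth (tail x)) S.
  rewrite setsumT big_ord_recl tnth_head_tail0; congr (_ + _).
  rewrite [RHS]big_enum_val; apply: eq_bigr => i _.
  by rewrite !tnth_subtuple /head_tail liftK.
rewrite /slack; split => [[[xB x0 xS] xP]|[/spl1[xB xP] x0 xS]].
  by split; [exact: spl2|exact: x0|rewrite lerBrDr].
by split => //; split => //; rewrite -lerBrDr.
Qed.

Lemma slack_hyperplane m t (S S' : {set 'I_m}) (x : m.-tuple RT) :
  slack (tnth x) t S = slack (tnth x) t S' ->
  linform (fun i => (i \in S)%:R - (i \in S')%:R) x =
    top_sum t #|S|.+1 - top_sum t #|S'|.+1.
Proof.
rewrite /slack !setsum_linform /linform => e.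
under eq_bigr do rewrite mulrBl.
rewrite sumrB; lra.
Qed.

Lemma indicator_neq m (S S' : {set 'I_m}) : S != S' ->
  exists i, (i \in S)%:R - (i \in S')%:R != 0 :> R.
Proof.
move=> SS'; apply: contrapT => H; move/eqP: SS'; apply; apply/finset.setP => i.
apply: contrapT => iSS'; apply: H; exists i.
by case: (i \in S) (i \in S') iSS' => -[] //= _; rewrite ?subr0 ?sub0r ?oppr_eq0 oner_eq0.
Qed.

(** On the overlap both sets minimize the slack, so their slacks agree: an equation
of a hyperplane, nontrivial because the two sets differ. *)
Lemma piece_overlap m t (S S' : {set 'I_m}) : S != S' ->
  mu (piece t S `&` piece t S') = 0%E.
Proof.
move=> SS'.
pose H := [set x : m.-tuple RT |
  linform (fun i => (i \in S)%:R - (i \in S')%:R) x =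
    top_sum t #|S|.+1 - top_sum t #|S'|.+1].
apply: (@subset_measure0 _ _ _ _ _ H).
- by apply: measurableI; exact: measurable_piece.
- exact: measurable_hyperplane.
- move=> x [/pieceP xS /pieceP xS']; apply: slack_hyperplane.
  by apply/eqP; rewrite eq_le !split_at_minimizer.
- by apply: hyperplane_null; exact: indicator_neq.
Qed.

Lemma tall_piece_overlap m t (S S' : {set 'I_m}) : S != S' ->
  mu (tall_piece t S `&` tall_piece t S') = 0%E.
Proof.
move=> SS'.
(* The hyperplane of [piece_overlap], with coefficient 0 on the head. *)
pose a (i : 'I_m.+1) : R :=
  if unlift ord0 i is Some j then (j \in S)%:R - (j \in S')%:R else 0.
pose H := [set x : m.+1.-tuple RT | linform a x = top_sum t #|S|.+1 - top_sum t #|S'|.+1].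
apply: (@subset_measure0 _ _ _ _ _ H).
- by apply: measurableI; exact: measurable_tall_piece.
- exact: measurable_hyperplane.
- move=> x [/tall_pieceP[xS _ _] /tall_pieceP[xS' _ _]].
  rewrite /H /= [x]subtuple_cons linform_cons {1}/a unlift_none mul0r add0r.
  rewrite -(@slack_hyperplane _ t S S' (tail x)).
    by apply: eq_bigr => i _; rewrite /a liftK.
  by apply/eqP; rewrite eq_le !split_at_minimizer.
- apply: hyperplane_null; have [i iSS'] := indicator_neq SS'.
  by exists (lift ord0 i); rewrite /a liftK.
Qed.

(** The pieces cover the polymatroid with null overlaps, and the volume of a piece
depends only on the size of its set. *)
Lemma pvol_recursion m t : m%:R <= t -> pvol m t =
  \sum_(k < m.+1) 'C(m, k)%:R * (bvol k * pvol (m - k) (t - k.+1%:R)).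
Proof.
move=> mt; apply: EFin_inj; rewrite -polymatroid_vol.
rewrite (_ : polymatroid m t = \bigcup_(S in [set: {set 'I_m}]) piece t S).
  rewrite measure_bigcup_null => [||S S']; last exact: piece_overlap.
    rewrite (eq_bigr _ (fun S _ => piece_vol t S)) sumEFin.
    by rewrite -(sum_card_subsets m (fun k => bvol k * pvol (m - k) (t - k.+1%:R))).
  by move=> S; exact: measurable_piece.
apply/seteqP; split => x /=.
  by move/(polymatroid_split x mt) => [S xS]; exists S => //; apply/pieceP.
by move=> [S _ /pieceP xS]; apply/(polymatroid_split x mt); exists S.
Qed.

Lemma pvolS_recursion m t : m%:R <= t -> pvol m.+1 t =
  \sum_(k < m.+1) 'C(m, k)%:R *
    (bvol k * (t - k%:R / 2) * pvol (m - k) (t - k.+1%:R)).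
Proof.
move=> mt; apply: EFin_inj; rewrite -polymatroid_vol.
rewrite (_ : polymatroid m.+1 t =
    \bigcup_(S in [set: {set 'I_m}]) tall_piece t S).
  rewrite measure_bigcup_null => [||S S']; last exact: tall_piece_overlap.
    rewrite (eq_bigr _ (fun S _ => tall_piece_vol S mt)) sumEFin.
    by rewrite -(sum_card_subsets m (fun k =>
      bvol k * (t - k%:R / 2) * pvol (m - k) (t - k.+1%:R))).
  by move=> S; exact: measurable_tall_piece.
apply/seteqP; split => x /=.
  by move/(polymatroid_split_tail x mt) => [S xS]; exists S => //; apply/tall_pieceP.
by move=> [S _ /tall_pieceP xS]; apply/(polymatroid_split_tail x mt); exists S.
Qed.

Lemma pvol0 t : pvol 0 t = 1.
Proof.
rewrite /pvol (_ : polymatroid 0 t = setT); first by rewrite /= indicT.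
apply/seteqP; split => // x _; split=> [[]//|A].
by rewrite /setsum big_pred0 => [|[]//]; rewrite eq_card0 ?top_sum0// => -[].
Qed.

Lemma bvol0 : bvol 0 = 1 :> R.
Proof.
rewrite /bvol (_ : block 0 0 = setT); first by rewrite /= indicT.
apply/seteqP; split => // x _ A.
rewrite /setsum big_pred0 => [|[]//]; rewrite eq_card0 => [|[]//].
by rewrite top_sum0 /bottom_sum !mul0r addr0 lexx.
Qed.

End recursions.

(** * Solving the recursions *)

Section solving_the_recursions.
Context {R : realType}.

(** The n-th finite difference of a polynomial of degree m < n vanishes.  Writing
one factor k + a as a sum, k times the binomial coefficient is absorbed by
passing from n to n - 1 and from a to a + 1. *)
Lemma alternating_sum_powers n m (a : R) : (m < n)%N ->
  \sum_(k < n.+1) 'C(n, k)%:R * (-1) ^+ k * (k%:R + a) ^+ m = 0.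
Proof.
elim: m => [|m IH] in n a * => mn.
  under eq_bigr do rewrite expr0 mulr1 mulr_natl.
  have := exprDn (1 : R) (-1) n; rewrite subrr expr0n.
  rewrite (negPf (lt0n_neq0 mn)) => /esym H; rewrite -[RHS]H.
  by apply: eq_bigr => k _; rewrite expr1n mul1r.
rewrite (eq_bigr (fun k : 'I_n.+1 =>
    a * ('C(n, k)%:R * (-1) ^+ k * (k%:R + a) ^+ m) +
    (k%:R * 'C(n, k)%:R) * (-1) ^+ k * (k%:R + a) ^+ m)); last first.
  by move=> k _; rewrite exprSr; ring.
rewrite big_split /= -big_distrr /= IH ?mulr0 ?add0r; last by lia.
case: n mn => // n mn; rewrite big_ord_recl /= !mul0r add0r.
transitivity (\sum_(k < n.+1) - n.+1%:R *
    ('C(n, k)%:R * (-1) ^+ k * (k%:R + (1 + a)) ^+ m)); last first.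
  by rewrite -big_distrr /= IH ?mulr0.
apply: eq_bigr => k _; rewrite /bump /= add1n -natrM -(mul_bin_diag n.+1 k) natrM /=.
by rewrite exprS -[k.+1]addn1 [(k + 1)%:R]natrD -[_ + 1%:R + a]addrA; ring.
Qed.

Lemma poly_eq_ge (p q : {poly R}) c :
  (forall t, c <= t -> p.[t] = q.[t]) -> p = q.
Proof.
move=> pq; apply/eqP; rewrite -subr_eq0; apply/eqP.
pose rs : seq R := [seq c + i%:R | i <- iota 0 (size (p - q))].
apply: (@roots_geq_poly_eq0 _ _ rs).
- apply/allP => _ /mapP[i _ ->]; rewrite rootE hornerD hornerN pq ?subrr//.
  by rewrite lerDl.
- rewrite map_inj_uniq ?iota_uniq// => i j /addrI /eqP.
  by rewrite eqr_nat => /eqP.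
- by rewrite size_map size_iota.
Qed.

Lemma mul_bin_swap m k i :
  ('C(m, k) * 'C(m - k, i) = 'C(m, i) * 'C(m - i, k))%N.
Proof.
have [kim|mki] := leqP (k + i) m; last first.
  have [km|/bin_small->] := leqP k m; have [im|/bin_small->] := leqP i m;
    rewrite ?mul0n//.
  - by rewrite (bin_small (n := m - k)) ?(bin_small (n := m - i)) ?muln0//; lia.
  - by rewrite (bin_small (n := m - k)) ?muln0//; lia.
  - by rewrite (bin_small (n := m - i)) ?muln0//; lia.
have fact_mid a b : (a + b <= m)%N ->
    ('C(m, a) * 'C(m - a, b) * (a`! * b`! * (m - a - b)`!) = m`!)%N.
  move=> abm; rewrite -(@bin_fact m a); last by lia.
  by rewrite -(@bin_fact (m - a) b); [ring|lia].
have pos : (0 < k`! * i`! * (m - k - i)`!)%N by rewrite !muln_gt0 !fact_gt0.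
apply/eqP; rewrite -(eqn_pmul2r pos) fact_mid// subnAC [(k`! * _)%N]mulnC.
by rewrite fact_mid// addnC.
Qed.

Variables (v : nat -> R -> R) (q : nat -> R).
Hypothesis v0 : forall t, v 0 t = 1.
Hypothesis q0 : q 0 = 1.
Hypothesis v_rec : forall m t, m%:R <= t -> v m t =
  \sum_(k < m.+1) 'C(m, k)%:R * (q k * v (m - k) (t - k.+1%:R)).
Hypothesis vS_rec : forall m t, m%:R <= t -> v m.+1 t =
  \sum_(k < m.+1) 'C(m, k)%:R *
    (q k * (t - k%:R / 2) * v (m - k) (t - k.+1%:R)).

(** Only t >= m - 1 is reached by the recursion; the identities below are between
polynomials that agree on a half-line. *)
Lemma recursion_polynomial m : exists p : {poly R}, forall t, m%:R - 1 <= t -> v m t = p.[t].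
Proof.
elim/ltn_ind: m => -[_|m IH].
  by exists 1 => t _; rewrite hornerC.
have /choice[p pE] j : exists p : {poly R}, (j < m.+1)%N ->
    forall t, j%:R - 1 <= t -> v j t = p.[t].
  have [jm|jm] := boolP (j < m.+1)%N; last by exists 0.
  by have [p pE] := IH _ jm; exists p.
exists (\sum_(k < m.+1) 'C(m, k)%:R%:P * ((q k)%:P * ('X - (k%:R / 2)%:P) *
    (p (m - k)%N \Po ('X - k.+1%:R%:P)))) => t mt.
have {}mt : m%:R <= t by move: mt; rewrite mulrSr addrK.
rewrite vS_rec// horner_sum; apply: eq_bigr => k _.
rewrite !(hornerM, hornerC, hornerXsubC, horner_comp) -pE//; first by lia.
have km : (k <= m)%N by rewrite -ltnS.
by rewrite natrB// mulrSr; lra.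
Qed.

Section appell.
Variable p : nat -> {poly R}.
Hypothesis pE : forall m t, m%:R - 1 <= t -> v m t = (p m).[t].

Let shift k j : {poly R} := p j \Po ('X - k.+1%:R%:P).

Lemma poly0E : p 0 = 1.
Proof.
by apply: (@poly_eq_ge _ _ 0) => t t0; rewrite -pE ?v0 ?hornerC//; lra.
Qed.

Lemma poly_rec m :
  p m = \sum_(k < m.+1) 'C(m, k)%:R *: (q k *: shift k (m - k)).
Proof.
apply: (@poly_eq_ge _ _ m%:R) => t mt; rewrite -pE; last by lra.
rewrite v_rec// horner_sum; apply: eq_bigr => k _.
rewrite !hornerZ horner_comp hornerXsubC -pE//.
have km : (k <= m)%N by rewrite -ltnS.
by rewrite natrB// mulrSr; lra.
Qed.

Lemma polyS_rec m : p m.+1 = \sum_(k < m.+1) 'C(m, k)%:R *: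
  (q k *: (('X - (k%:R / 2)%:P) * shift k (m - k))).
Proof.
apply: (@poly_eq_ge _ _ m%:R) => t mt; rewrite -pE; last by rewrite mulrSr; lra.
rewrite vS_rec// horner_sum; apply: eq_bigr => k _.
have km : (k <= m)%N by rewrite -ltnS.
rewrite !hornerZ hornerM horner_comp !hornerXsubC -pE.
  by rewrite -[q k * _ * _]mulrA.
by rewrite natrB// mulrSr; lra.
Qed.

Lemma deriv_shift k j : (shift k j)^`() = (p j)^`() \Po ('X - k.+1%:R%:P).
Proof. by rewrite deriv_comp derivXsubC mulr1. Qed.

(** In the derivative of the recursion for p m.+1, the terms where the linear factor
is differentiated sum up to p m by the first recursion, and the other terms to
m times p m by the induction hypothesis and the second recursion for p m. *)
Lemma deriv_appell m : (p m.+1)^`() = m.+1%:R *: p m.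
Proof.
elim/ltn_ind: m => m IH.
rewrite polyS_rec raddf_sum /=.
under eq_bigr => k _ do rewrite !derivZ derivM derivXsubC mul1r deriv_shift
  !scalerDr.
rewrite big_split /= -poly_rec -[in RHS]addn1 natrD addrC scalerDl scale1r.
congr (_ + _); case: m => [|m] in IH *.
  by rewrite big_ord1 poly0E derivC comp_poly0 mulr0 !scaler0 scale0r.
rewrite big_ord_recr /= subnn poly0E derivC comp_poly0 mulr0 !scaler0 addr0.
rewrite [in RHS]polyS_rec scaler_sumr; apply: eq_bigr => k _.
have km : (k <= m)%N by rewrite -ltnS.
rewrite subSn// IH; last by lia.
rewrite comp_polyZ -!scalerAr !scalerA; congr (_ *: _).
have := mul_bin_down m.+1 k; rewrite /= subSn// => /(congr1 (GRing.natmul (1 : R))).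
rewrite !natrM => H.
transitivity ((m - k).+1%:R * 'C(m.+1, k)%:R * q k); first by ring.
by rewrite -H; ring.
Qed.

Lemma coef_appell m j : (p m)`_j = 'C(m, j)%:R * (p (m - j))`_0.
Proof.
elim: j => [|j IH] in m *; first by rewrite bin0 mul1r subn0.
case: m => [|m]; first by rewrite poly0E coefC mul0r.
have := congr1 (fun r : {poly R} => r`_j) (deriv_appell m).
rewrite coef_deriv coefZ IH subSS mulrA -natrM mul_bin_diag natrM -mulrA => H.
have j1 : j.+1%:R != 0 :> R by rewrite pnatr_eq0.
by apply: (mulfI j1); rewrite -H mulr_natl.
Qed.

(** All the leading coefficients are 1, as the first polynomial is 1. *)
Lemma size_appell m : size (p m) = m.+1.
Proof.
have pm : (p m)`_m = 1 by rewrite coef_appell binn mul1r subnn poly0E coefC.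
apply/eqP; rewrite eqn_leq; apply/andP; split.
  by apply/leq_sizeP => j mj; rewrite coef_appell bin_small// mul0r.
by apply: contraTT (oner_neq0 R) => /=; rewrite -ltnNge ltnS => /leq_sizeP/(_ m);
  rewrite leqnn pm => /(_ isT) ->; rewrite eqxx.
Qed.

(** Evaluated at 0, the first recursion becomes
c m = sum_i C(m, i) * c i * B (m - i) for the constant terms c i and the sums B n
to be shown zero.  Since B 0 = 1, the term i = m cancels c m, and by induction
only the term i = 0, which is B m, remains. *)
Lemma weights_alternating n : (0 < n)%N ->
  \sum_(k < n.+1) 'C(n, k)%:R * q k * (- k.+1%:R) ^+ (n - k) = 0.
Proof.
pose B n := \sum_(k < n.+1) 'C(n, k)%:R * q k * (- k.+1%:R) ^+ (n - k).
pose c j := (p j)`_0.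
have p_c m (a : R) :
    (p m).[a] = \sum_(i < m.+1) 'C(m, i)%:R * c i * a ^+ (m - i).
  rewrite (horner_coef_wide _ (eq_leq (size_appell m))) (reindex_inj rev_ord_inj) /=.
  apply: eq_bigr => i _; rewrite coef_appell subSS bin_sub -1?ltnS//.
  by rewrite subKn// -ltnS.
have cB m : c m = \sum_(i < m.+1) 'C(m, i)%:R * c i * B (m - i)%N.
  (* Binomial coefficients out of range vanish, so both sums may run up to m and be
   exchanged freely. *)
  pose F (k i : nat) := 'C(m, k)%:R * 'C(m - k, i)%:R * q k * c i *
     (- k.+1%:R) ^+ (m - k - i) : R.
  transitivity (\sum_(k < m.+1) \sum_(i < m.+1) F k i).
    rewrite /c -horner_coef0 {1}poly_rec horner_sum; apply: eq_bigr => k _.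
    rewrite !hornerZ /shift horner_comp hornerXsubC sub0r p_c.
    have mk : ((m - k).+1 <= m.+1)%N by rewrite ltnS leq_subr.
    rewrite (big_ord_widen _ (fun i => 'C(m - k, i)%:R * c i *
      (- k.+1%:R) ^+ (m - k - i)) mk) !big_distrr /= big_mkcond /=.
    apply: eq_bigr => i _; rewrite /F; case: ltnP => [_|]; first by ring.
    by move/bin_small => ->; rewrite !(mulr0, mul0r).
  rewrite exchange_big /=; apply: eq_bigr => i _.
  have mi : ((m - i).+1 <= m.+1)%N by rewrite ltnS leq_subr.
  rewrite /B (big_ord_widen _ (fun k => 'C(m - i, k)%:R * q k *
      (- k.+1%:R) ^+ (m - i - k)) mi) !big_distrr /= [RHS]big_mkcond /=.
  apply: eq_bigr => k _; rewrite /F.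
  have -> : 'C(m, k)%:R * 'C(m - k, i)%:R = 'C(m, i)%:R * 'C(m - i, k)%:R :> R.
    by rewrite -!natrM mul_bin_swap.
  rewrite subnAC; case: ltnP => [_|]; first by ring.
  by move/bin_small => ->; rewrite !(mulr0, mul0r).
have c0 : c 0 = 1 by rewrite /c poly0E coefC.
have B0 : B 0 = 1 by rewrite /B big_ord1 subnn expr0 q0 bin0 !mulr1.
elim/ltn_ind: n => -[//|n] IH _; rewrite -/(B n.+1).
have := cB n.+1; rewrite big_ord_recl big_ord_recr /= /bump /= !add1n.
rewrite bin0 binn subn0 subnn c0 B0 !mul1r mulr1 big1 => [|i _]; first by lra.
rewrite /bump /= !add1n subSS -/(B _) [B _]IH ?mulr0//; last by rewrite subn_gt0.
by rewrite ltnS leq_subr.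
Qed.

(** The numbers k.+1 ^ (k - 1) turn the alternating relation into a finite difference
of order n.+1 of a polynomial of degree n, and each relation determines the next
weight.  The division makes the formula cover k = 0. *)
Lemma weights_of_recursions n : q n = n.+1%:R ^+ n / n.+1%:R.
Proof.
elim/ltn_ind: n => -[_|n IH]; first by rewrite q0 expr0 divr1.
have := weights_alternating (ltn0Sn n).
have := @alternating_sum_powers n.+1 n 1 (ltnSn n).
have n2 : n.+2%:R != 0 :> R by rewrite pnatr_eq0.
pose s k : R := (-1) ^+ k.
have ss k : s k * s k = 1 by rewrite /s -exprMn mulrNN mulr1 expr1n.
have term k : (k <= n)%N -> 'C(n.+1, k)%:R * (-1) ^+ k * (k%:R + 1) ^+ n =
    s n.+1 * ('C(n.+1, k)%:R * q k * (- k.+1%:R) ^+ (n.+1 - k)).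
  move=> kn; rewrite IH// subSn//.
  have -> : (- k.+1%:R) ^+ (n - k).+1 =
      s (n - k).+1 * (k.+1%:R * k.+1%:R ^+ (n - k)) :> R.
    by rewrite exprNn -exprS.
  have -> : s n.+1 = s (n - k).+1 * s k.
    by rewrite /s -exprD; congr (_ ^+ _); lia.
  have -> : (k%:R + 1) ^+ n = k.+1%:R ^+ (n - k) * k.+1%:R ^+ k :> R.
    by rewrite natr1 -exprD subnK.
  have k1 : k.+1%:R != 0 :> R by rewrite pnatr_eq0.
  rewrite -/(s k) -[LHS]mul1r -[X in X * _](ss (n - k).+1).
  by field; rewrite addrC natr1.
rewrite big_ord_recr [X in _ -> X = 0 -> _]big_ord_recr /=.
rewrite (eq_bigr _ (fun (k : 'I_n.+1) _ => term k (ltn_ord k))) -big_distrr /=.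
move=> sum_pow /eqP; rewrite addr_eq0 => /eqP sum_q; move: sum_pow.
rewrite sum_q.
rewrite subnn !binn expr0 natr1 -/(s n.+1) !mul1r mulr1 mulrN => /eqP.
rewrite addrC subr_eq0 => /eqP /(congr1 ( *%R (s n.+1))).
by rewrite !mulrA ss !mul1r exprSr mulfK.
Qed.

End appell.
End solving_the_recursions.

(** * The recursion for the normalized volume *)

Section main.
Local Open Scope classical_set_scope.
Context {R : realType}.

Lemma volume_partial_permutohedron m n : (m <= n.+1)%N ->
  fine (volume (@partial_permutohedron R m n)) = pvol m n%:R.
Proof.
move=> mn; rewrite partial_permutohedronE// /pvol; congr (fine (lebesgue_tuple _)).
apply/seteqP; split => x;
  by rewrite /polymatroid /mkset (_ : (\row_i tnth x i) ord0 = tnth x)//;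
  apply/funext => i; rewrite mxE.
Qed.

Lemma bvol_value k : bvol k = k.+1%:R ^+ k / k.+1%:R :> R.
Proof.
have /choice[p pE] := recursion_polynomial (@pvol0 R) (@pvolS_recursion R).
exact: (weights_of_recursions (@pvol0 R) (@bvol0 R) (@pvol_recursion R) (@pvolS_recursion R) pE).
Qed.

Lemma pvol_poly m : exists p : {poly R}, size p = m.+1 /\
  forall t, m%:R - 1 <= t -> pvol m t = p.[t].
Proof.
have /choice[p pE] := recursion_polynomial (@pvol0 R) (@pvolS_recursion R).
exists (p m); split; last exact: pE.
exact: (size_appell (@pvol0 R) (@pvol_recursion R) (@pvolS_recursion R) pE).
Qed.

(** The conventions for the pairs (0, n) and (1, 0) agree with the polymatroid:
it is a single point in both cases. *)
Lemma nvolumeE m (n : int) : m%:Z - 1 <= n -> nvolume R m n = m`!%:R * pvol m n%:~R.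
Proof.
case: m => [|m] mn; first by rewrite /= fact0 mul1r pvol0.
move: mn; rewrite intS addrAC subrr add0r; case: n => // n mn.
have pos_case : nvolume R m.+1 n =
    m.+1`!%:R * fine (volume (@partial_permutohedron R m.+1 n)) ->
    nvolume R m.+1 n = m.+1`!%:R * pvol m.+1 n%:R.
  by move=> ->; rewrite volume_partial_permutohedron.
case: m n mn pos_case => [|m] [|n] mn pos_case; try exact: pos_case.
by rewrite /= pvolS_recursion// big_ord1 mul0r subr0 mulr0 mul0r !mulr0.
Qed.

Lemma nvolume_recursion m (n : int) : m%:Z <= n ->
  nvolume R m.+1 n = m`!%:R * \sum_(1 <= k < m.+2)
    (k%:R : R) ^ (k%:Z - 2%:Z) *
    (nvolume R (m.+1 - k)%N (n - k%:Z) / (m.+1 - k)`!%:R) *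
    (k%:R * n%:~R - 'C(k, 2)%:R) * 'C(m.+1, k)%:R.
Proof.
move=> mn; rewrite nvolumeE; last by rewrite intS addrAC subrr add0r.
rewrite pvolS_recursion; last by rewrite pmulrn ler_int.
rewrite big_add1 big_mkord /= factS natrM [_ * m`!%:R]mulrC -mulrA big_distrr.
congr (_ * _); apply: eq_bigr => k _ /=.
have km : (k <= m)%N by rewrite -ltnS.
rewrite subSS nvolumeE; last by lia.
have fact_neq0 : (m - k)`!%:R != 0 :> R by rewrite pnatr_eq0 -lt0n fact_gt0.
have k1 : k.+1%:R != 0 :> R by rewrite pnatr_eq0.
rewrite [(m - k)`!%:R * _]mulrC mulfK// rmorphB /= bvol_value.
have -> : (k.+1%:R : R) ^ (k.+1%:Z - 2%:Z) = k.+1%:R ^+ k / k.+1%:R.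
  rewrite (_ : k.+1%:Z - 2%:Z = k%:Z - 1); last by lia.
  by rewrite expfzDr// exprN1.
have bin2E : 'C(k.+1, 2)%:R = k.+1%:R * k%:R / 2 :> R.
  have : k.+1%:R * k%:R = 2 * 'C(k.+1, 2)%:R :> R.
    by rewrite -!natrM -(mul_bin_diag k.+1 1) bin1.
  by move=> ->; rewrite mulrAC mulfV ?mul1r// pnatr_eq0.
have binS : 'C(m.+1, k.+1)%:R = m.+1%:R * 'C(m, k)%:R / k.+1%:R :> R.
  by rewrite -natrM mul_bin_diag natrM mulrAC mulfV// mul1r.
rewrite bin2E binS -pmulrn; set w := k.+1%:R ^+ k; set y := pvol _ _.
by field.
Qed.

End main.

Theorem theorem4p1 (R : realType) :
  [/\ forall m n : nat, (0 < m)%N -> (0 < n)%N -> (m.-1 <= n)%N ->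
        nvolume R m n%:Z =
        (m.-1)`!%:R *
        \sum_(1 <= k < m.+1)
          (k%:R : R) ^ (k%:Z - 2%:Z) *
          (nvolume R (m - k)%N (n%:Z - k%:Z) / (m - k)`!%:R) *
          (k%:R * n%:R - 'C(k, 2)%:R) * 'C(m, k)%:R,
      forall n : int, -1 <= n -> nvolume R 0 n = 1,
      nvolume R 1 0 = 0
    & forall m : nat, (0 < m)%N ->
        exists p : {poly R}, size p = m.+1 /\
          forall n : nat, (m.-1 <= n)%N -> nvolume R m n%:Z = p.[n%:R]].
Proof.
split => //.
- by move=> [//|m] n _ _ mn; exact: nvolume_recursion.
- move=> [//|m] _; have [p [sp pE]] := @pvol_poly R m.+1.
  exists (m.+1`!%:R *: p); split.
    by rewrite size_scale// pnatr_eq0 -lt0n fact_gt0.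
  move=> n mn; have mn' : m%:R <= n%:R :> R by rewrite ler_nat.
  rewrite hornerZ -pE; last by rewrite mulrSr addrK.
  by apply: nvolumeE; rewrite intS addrAC subrr add0r.
Qed.
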